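(* Let $(A_r)_{r\ge 0}$ be a sequence of diagram algebras over an integral domain $R$ with field of fractions $\mathbb{F}$ (see context), and assume that it has an additive or multiplicative family of Jucys–Murphy elements $\{L_i:i\ge1\}$. Then the Jucys–Murphy elements act triangularly with respect to dominance order on the Murphy basis of the cell modules; that is, for $r\ge1$, $\lambda\in\widehat A_r$, $\mathsf t\in\mathrm{Std}_r(\lambda)$ and $1\le i\le r$, $$m^\lambda_{\mathsf t}L_i=\kappa_{\mathsf t}(i)\,m^\lambda_{\mathsf t}+\sum_{\mathsf s\in\mathrm{Std}_r(\lambda),\ \mathsf s\triangleright\mathsf t}r_{\mathsf s}\,m^\lambda_{\mathsf s},$$ where the coefficients are in $R$.
   Context: **Cellular algebras.** A cellular algebra over $R$ is a unital $R$-algebra $A$ with an algebra involution $*$ ($R$-linear anti-automorphism, $(x^* )^*=x$), a finite poset $(\widehat A,\trianglerighteq)$, a finite index set $T(\lambda)$ for each $\lambda\in\widehat A$, and an $R$-basis $\{c^\lambda_{st}:\lambda\in\widehat A,\ s,t\in T(\lambda)\}$ such that, with $A^{\triangleright\lambda}$ (resp. $A^{\trianglerighteq\lambda}$) the span of the $c^\mu_{st}$ with $\mu\triangleright\lambda$ (resp. $\mu\trianglerighteq\lambda$): (a) for $t\in T(\lambda)$, $a\in A$ there are $r(a;t,v)\in R$ with $c^\lambda_{st}a\equiv\sum_v r(a;t,v)c^\lambda_{sv}$ mod $A^{\triangleright\lambda}$ for all $s$; (b) $(c^\lambda_{st})^*\equiv c^\lambda_{ts}$ mod $A^{\triangleright\lambda}$.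 The cell module $\Delta(\lambda)$ is the right $A$-module, free over $R$ on $\{c^\lambda_t\}$, with $c^\lambda_t a=\sum_v r(a;t,v)c^\lambda_v$. There is an $A$-$A$-bimodule isomorphism $\alpha_\lambda:A^{\trianglerighteq\lambda}/A^{\triangleright\lambda}\to\Delta(\lambda)^*\otimes_R\Delta(\lambda)$, $c^\lambda_{st}+A^{\triangleright\lambda}\mapsto (c^\lambda_s)^*\otimes c^\lambda_t$, where $M^*$ is the left module obtained from a right module $M$ via $*$. $A$ is cyclic cellular if every cell module is cyclic. A cell filtration of a right module is a finite filtration $0=M_0\subseteq\dots\subseteq M_p$ with $M_i/M_{i-1}\cong\Delta(\lambda^{(i)})$; it is order preserving if $\lambda^{(i)}\triangleright\lambda^{(i+1)}$ for all $i$. **Sequence of diagram algebras.** $(A_r)_{r\ge0}$ is an increasing sequence of cellular algebras over $R$, with unital inclusions and compatible involutions; $\widehat A_r$ is the poset of $A_r$, $\Delta_r(\lambda)$ its cell modules, $A_r^{\mathbb F}=A_r\otimes_R\mathbb F$, $\Delta_r^{\mathbb F}(\lambda)=\Delta_r(\lambda)\otimes_R\mathbb F$. For each $\lambda\in\widehat A_r$ a generator $\delta_r(\lambda)$ of $\Delta_r(\lambda)$ and an element $m_\lambda\in A_r^{\trianglerighteq\lambda}$ with $\alpha_\lambda(m_\lambda+A_r^{\triangleright\lambda})=\delta_r(\lambda)^*\otimes\delta_r(\lambda)$ are fixed; $\Delta_r(\lambda)$ is identified with $(m_\lambda A_r+A_r^{\triangleright\lambda})/A_r^{\triangleright\lambda}$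 via $\delta_r(\lambda)a\leftrightarrow m_\lambda a+A_r^{\triangleright\lambda}$. Axioms: (D1) $A_0=R$ ($\widehat A_0=\{\varnothing\}$, $\Delta_0(\varnothing)=R$, $m_\varnothing=1$); (D2) each $A_r$ is cyclic cellular; (D3) $m_\lambda=m_\lambda^*$; (D4) each $A_r^{\mathbb F}$ is split semisimple; (D5) (restriction coherence) for each $\mu\in\widehat A_{r+1}$ the restriction of $\Delta_{r+1}(\mu)$ to $A_r$ has an order preserving cell filtration; (D6) below. **Branching diagram, branching factors.** $\widehat A$ is the graded directed graph with vertex set $\widehat A_r$ at level $r$ and an edge $\lambda\to\mu$ ($\lambda\in\widehat A_{r-1}$, $\mu\in\widehat A_r$) iff $\Delta_{r-1}(\lambda)$ is a subquotient in the order preserving cell filtration of the restriction of $\Delta_r(\mu)$ to $A_{r-1}$. Fixing such a filtration $(M_j)$ with isomorphisms $M_j/M_{j-1}\cong\Delta_{r-1}(\lambda_j)$, the branching factor $d_{\lambda_j\to\mu}\in A_r$ is a chosen element with $\delta_r(\mu)d_{\lambda_j\to\mu}\in M_j$ whose class in $M_j/M_{j-1}$ corresponds to $\delta_{r-1}(\lambda_j)$. (D6): there are elements $u_{\mu\to\lambda}\in A_{r+1}$ for each edge $\mu\to\lambda$ ($\mu\in\widehat A_r,\lambda\in\widehat A_{r+1}$) with $m_\lambda d_{\mu\to\lambda}=(u_{\mu\to\lambda})^*m_\mu$. **Paths, Murphy basis, dominance order.** $\mathrm{Std}_r(\nu)$ is the set of directed paths $\mathsf t=(\varnothing=\mathsf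 t(0)\to\mathsf t(1)\to\dots\to\mathsf t(r)=\nu)$. For such $\mathsf t$, $d_{\mathsf t}=d_{\mathsf t(r-1)\to\mathsf t(r)}\cdots d_{\mathsf t(0)\to\mathsf t(1)}$. The Murphy basis $m^\nu_{\mathsf t}=m_\nu d_{\mathsf t}+A_r^{\triangleright\nu}$, $\mathsf t\in\mathrm{Std}_r(\nu)$, is known to be an $R$-basis of $\Delta_r(\nu)$. For paths, $\mathsf s\trianglerighteq\mathsf t$ iff $\mathsf s(j)\trianglerighteq\mathsf t(j)$ for all $j$; $\mathsf s\triangleright\mathsf t$ means in addition $\mathsf s\ne\mathsf t$. **Jucys–Murphy elements.** $\{L_r:r\ge1\}$ is an additive family of Jucys–Murphy elements if (1) for all $r\ge1$, $L_r\in A_r$, $L_r^*=L_r$, and $L_r$ commutes with $A_{r-1}$; (2) for all $r\ge1$ and $\lambda\in\widehat A_r$ there is $d(\lambda)\in R$ such that $L_1+\dots+L_r$ acts as the scalar $d(\lambda)$ on $\Delta_r(\lambda)$; and $d(\varnothing)=0$ for $\varnothing\in\widehat A_0$. It is a multiplicative family if (1) for all $r\ge1$, $L_r$ is an invertible element of $A_r$, $L_r^*=L_r$, and $L_r$ commutes with $A_{r-1}$; (2) for all $r\ge1$ and $\lambda\in\widehat A_r$ there is $d(\lambda)\in R$ such that $L_1\cdots L_r$ acts as the scalar $d(\lambda)$ on $\Delta_r(\lambda)$; and $d(\varnothing)=1$. **The scalars.** $\kappa_{\mathsf t}(i)=\kappa_{\mathsf t(i-1)\to\mathsf t(i)}$,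 where for an edge $\mu\to\lambda$ of $\widehat A$, $\kappa_{\mu\to\lambda}=d(\lambda)-d(\mu)\in R$ in the additive case and $\kappa_{\mu\to\lambda}=d(\lambda)d(\mu)^{-1}\in R$ in the multiplicative case (these are the eigenvalues of $L_i$ on the seminormal basis vectors $f^\lambda_{\mathsf t}=m^\lambda_{\mathsf t}F_{\mathsf t}$, where $F_{\mathsf t}=\prod_{s=1}^r z_s^{\mathsf t(s)}$ and $z_s^\mu$ is the minimal central idempotent of $A_s^{\mathbb F}$ corresponding to $\Delta_s^{\mathbb F}(\mu)$). *)

(* Defs.v *)
From HB Require Import structures.
From mathcomp Require Import all_boot all_order all_algebra.

Set Implicit Arguments.
Unset Strict Implicit.
Unset Printing Implicit Defensive.

Import Order.TTheory GRing.Theory.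
Local Open Scope ring_scope.

(** * Finite bases of modules, scalar extension, split semisimple algebras *)

Section Bases.
Variables (R : nzRingType) (V : lmodType R) (I : finType).

Definition is_basis (b : I -> V) : Prop :=
  forall v : V, exists! f : {ffun I -> R}, v = \sum_i f i *: b i.

Definition in_span (b : I -> V) (P : pred I) (v : V) : Prop :=
  exists f : I -> R, v = \sum_(i | P i) f i *: b i.

Lemma basis_coord_ex (b : I -> V) (bP : is_basis b) (v : V) :
  exists f : {ffun I -> R}, v == \sum_i f i *: b i.
Proof. by have [f [/eqP fP _]] := bP v; exists f. Qed.

Definition basis_coord (b : I -> V) (bP : is_basis b) (v : V) : {ffun I -> R} :=
  xchoose (basis_coord_ex bP v).

End Bases.

(** [B], together with the ring morphism [phi], is the F-algebra A (x)_R F,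
    F = Frac R, for an R-algebra A with finite R-basis [b]: the map [phi] is
    a |-> a (x) 1, and the elements [phi (b i)] form an F-basis. *)
Definition is_scalar_extension (R : idomainType) (A : algType R) (I : finType)
    (b : I -> A) (B : algType {fraction R}) (phi : {rmorphism A -> B}) : Prop :=
  (forall (k : R) (a : A), phi (k *: a) = FracField.tofrac k *: phi a)
  /\ is_basis (fun i => phi (b i)).

(** Isomorphic to a finite direct product of full matrix algebras over K. *)
Definition split_semisimple (K : fieldType) (B : algType K) : Prop :=
  exists (l : nat) (n : 'I_l -> nat)
         (pi : forall i : 'I_l, {lrmorphism B -> 'M[K]_((n i).+1)}),
    forall y : (forall i : 'I_l, 'M[K]_((n i).+1)),
      exists! x : B, forall i, pi i x = y i.

(** * Cellular algebras *)

(** The mathematical order [λ ⊵ μ] is [(μ <= λ)%O]. *)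
Record cellular (R : idomainType) (A : algType R) := Cellular {
  star : A -> A;
  star_linear : linear star;
  starM : forall a b : A, star (a * b) = star b * star a;
  starK : involutive star;
  cell_disp : Order.disp_t;
  cell_idx : finPOrderType cell_disp;
  cell_tab : cell_idx -> finType;
  cbas : forall l : cell_idx, cell_tab l -> cell_tab l -> A;
  cbas_basis :
    is_basis (fun i : {l : cell_idx & (cell_tab l * cell_tab l)%type} =>
                cbas (tagged i).1 (tagged i).2);
  cell_coef : forall l : cell_idx, A -> cell_tab l -> cell_tab l -> R;
  cbas_mul : forall (l : cell_idx) (t : cell_tab l) (a : A) (s : cell_tab l),
    in_span (fun i : {l : cell_idx & (cell_tab l * cell_tab l)%type} =>
               cbas (tagged i).1 (tagged i).2)
            (fun i => (l < tag i)%O)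
            (cbas s t * a - \sum_v cell_coef a t v *: cbas s v);
  cbas_star : forall (l : cell_idx) (s t : cell_tab l),
    in_span (fun i : {l : cell_idx & (cell_tab l * cell_tab l)%type} =>
               cbas (tagged i).1 (tagged i).2)
            (fun i => (l < tag i)%O)
            (star (cbas s t) - cbas t s)
}.

Section Cellular.
Variables (R : idomainType) (A : algType R) (C : cellular A).

Definition cbas_ind : finType :=
  {l : cell_idx C & (cell_tab l * cell_tab l)%type}.

Definition cbas_fam (i : cbas_ind) : A := cbas (tagged i).1 (tagged i).2.

Definition cbas_famP : is_basis cbas_fam := cbas_basis C.

Variable l : cell_idx C.

(** A^{▷ l} and A^{⊵ l}. *)
Definition cell_gt (a : A) : Prop := in_span cbas_fam (fun i => (l < tag i)%O) a.
Definition cell_ge (a : A) : Prop := in_span cbas_fam (fun i => (l <= tag i)%O) a.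

(** Equality of the cosets of [a] and [b] modulo A^{▷ l}. *)
Definition cell_eq (a b : A) : Prop := cell_gt (a - b).

(** The cell module Δ(l): the free R-module on [cell_tab l], with right action
    c_t a = \sum_v r(a; t, v) c_v extended R-linearly. *)
Definition cell_module : lmodType R := {ffun cell_tab l -> R^o}.

Definition cell_act (x : cell_module) (a : A) : cell_module :=
  [ffun v => \sum_t (x t : R) * cell_coef a t v].

(** Δ(l)^* (x)_R Δ(l) is the free R-module on pairs (s, t), the basis element
    (s, t) standing for (c_s)^* (x) c_t. *)
Definition cell_tensor (x y : cell_module) :
    {ffun cell_tab l * cell_tab l -> R} :=
  [ffun st => (x st.1 : R) * (y st.2 : R)].

(** α_l : A^{⊵ l} / A^{▷ l} -> Δ(l)^* (x)_R Δ(l), c_st + A^{▷ l} |-> (c_s)^* (x) c_t,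
    as a function of representatives: it reads off the coordinates along the
    c^l_st (on A^{⊵ l}, these all vanish exactly on A^{▷ l}). *)
Definition cell_alpha (a : A) : {ffun cell_tab l * cell_tab l -> R} :=
  [ffun st => basis_coord cbas_famP a
     (@Tagged (cell_idx C) l
        (fun l' => (cell_tab l' * cell_tab l')%type) st)].

End Cellular.

(** * Increasing sequences of cellular algebras *)

Record cell_tower (R : idomainType) := CellTower {
  alg : nat -> algType R;
  cel : forall r, cellular (alg r);
  inc : forall r, {lrmorphism alg r -> alg r.+1};
  inc_inj : forall r, injective (inc r);
  inc_star : forall r (a : alg r),
    inc r (star (cel r) a) = star (cel r.+1) (inc r a)
}.

Section Tower.
Variables (R : idomainType) (A : cell_tower R).

Definition Lam (r : nat) := cell_idx (cel A r).

Definition Delta (r : nat) (l : Lam r) : lmodType R := cell_module l.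

Fixpoint incl_add (i k : nat) : alg A i -> alg A (k + i) :=
  match k with
  | 0 => fun a => a
  | k'.+1 => fun a => inc A (k' + i) (incl_add k' a)
  end.

(** The inclusion A_i -> A_r, for i <= r. *)
Definition incl (i r : nat) (le_ir : (i <= r)%N) (a : alg A i) : alg A r :=
  ecast n (alg A n) (subnK le_ir) (incl_add (r - i) a).

(** Right A_r-submodules of the restriction of Δ_{r+1}(mu) to A_r. *)
Definition res_submodule (r : nat) (mu : Lam r.+1) (M : Delta mu -> Prop) :
    Prop :=
  [/\ M 0,
      forall (k : R) (x y : Delta mu), M x -> M y -> M (k *: x + y)
    & forall (x : Delta mu) (a : alg A r), M x -> M (cell_act x (inc A r a))].

(** [phi] induces an isomorphism of right A_r-modules M / N ≅ Δ_r(l), where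
    N ⊆ M are submodules of the restriction of Δ_{r+1}(mu) to A_r; the values
    of [phi] outside M are irrelevant. *)
Definition res_quotient_iso (r : nat) (mu : Lam r.+1) (l : Lam r)
    (M N : Delta mu -> Prop) (phi : Delta mu -> Delta l) : Prop :=
  [/\ forall (k : R) (x y : Delta mu), M x -> M y ->
        phi (k *: x + y) = k *: phi x + phi y,
      forall (x : Delta mu) (a : alg A r), M x ->
        phi (cell_act x (inc A r a)) = cell_act (phi x) a,
      forall y : Delta l, exists2 x, M x & phi x = y
    & forall x : Delta mu, M x -> (phi x = 0 <-> N x)].

(** An order preserving cell filtration 0 = M_0 ⊆ ... ⊆ M_p of the restriction
    of Δ_{r+1}(mu) to A_r, with chosen isomorphisms
    M_{j+1} / M_j ≅ Δ_r(λ_j), 0 <= j < p. *)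
Record cell_filtration (r : nat) (mu : Lam r.+1) := CellFiltration {
  filt_len : nat;
  filt_lam : 'I_filt_len -> Lam r;
  filt_mod : nat -> Delta mu -> Prop;
  filt_iso : forall j : 'I_filt_len, Delta mu -> Delta (filt_lam j);
  filt_submod : forall j, (j <= filt_len)%N -> res_submodule (filt_mod j);
  filt_bot : forall x, filt_mod 0 x <-> x = 0;
  filt_top : forall x, filt_mod filt_len x;
  filt_incr : forall (j : 'I_filt_len) x, filt_mod j x -> filt_mod j.+1 x;
  filt_isoP : forall j : 'I_filt_len,
    res_quotient_iso (filt_mod j.+1) (filt_mod j) (filt_iso j);
  filt_order : forall i j : 'I_filt_len,
    j = i.+1 :> nat -> (filt_lam j < filt_lam i)%O
}.

End Tower.

(** * Sequences of diagram algebras *)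

Record diagram_data (R : idomainType) := DiagramData {
  tower :> cell_tower R;
  Lam_root : Lam tower 0;
  delta : forall (r : nat) (l : Lam tower r), Delta l;
  cell_m : forall (r : nat), Lam tower r -> alg tower r;
  res_filt : forall (r : nat) (mu : Lam tower r.+1), cell_filtration mu;
  bfac : forall (r : nat), Lam tower r -> Lam tower r.+1 -> alg tower r.+1
}.

Section Diagram.
Variables (R : idomainType) (A : diagram_data R).

Definition edge (r : nat) (l : Lam A r) (mu : Lam A r.+1) : bool :=
  [exists j, filt_lam (r := r) (mu := mu) (c := res_filt mu) j == l].

Record diagram_axioms : Prop := DiagramAxioms {
  delta_cyclic : forall (r : nat) (l : Lam A r) (x : Delta l),
    exists a : alg A r, x = cell_act (delta l) a;
  cell_m_ge : forall (r : nat) (l : Lam A r), cell_ge l (cell_m l);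
  cell_m_alpha : forall (r : nat) (l : Lam A r),
    cell_alpha l (cell_m l) = cell_tensor (delta l) (delta l);
  (* A_0 = R *)
  alg0_triv : bijective (fun x : R => x%:A : alg A 0);
  Lam0_triv : forall l : Lam A 0, l = Lam_root A;
  Delta0_triv : #|{: cell_tab (Lam_root A)}| = 1%N;
  cell_m0 : cell_m (Lam_root A) = 1;
  cell_m_star : forall (r : nat) (l : Lam A r),
    star (cel A r) (cell_m l) = cell_m l;
  generic_semisimple : forall r : nat,
    exists (B : algType {fraction R}) (phi : {rmorphism alg A r -> B}),
      is_scalar_extension (@cbas_fam R (alg A r) (cel A r)) phi
      /\ split_semisimple B;
  bfac_filt : forall (r : nat) (mu : Lam A r.+1)
                     (j : 'I_(filt_len (res_filt mu))),
    let x := cell_act (delta mu) (bfac (filt_lam j) mu) in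
    filt_mod (res_filt mu) j.+1 x /\ filt_iso j x = delta (filt_lam j);
  bfac_compat : forall (r : nat) (mu : Lam A r) (l : Lam A r.+1),
    edge mu l ->
    exists u : alg A r.+1,
      cell_m l * bfac mu l = star (cel A r.+1) u * inc A r (cell_m mu)
}.

(** Paths (t(0), ..., t(r)) with t(i) in \hat A_i.  For [i : 'I_r], the vertices
    t(i) and t(i+1) are [path_src t i] and [path_tgt t i]. *)
Definition vpath (r : nat) : finType := {dffun forall i : 'I_r.+1, Lam A i}.

Definition path_src (r : nat) (t : vpath r) (i : 'I_r) : Lam A i :=
  t (widen_ord (leqnSn r) i).
Definition path_tgt (r : nat) (t : vpath r) (i : 'I_r) : Lam A i.+1 :=
  t (lift ord0 i).

Definition Std (r : nat) (nu : Lam A r) : {set vpath r} :=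
  [set t : vpath r | [&& (t ord0 : Lam A 0) == Lam_root A,
                         [forall i : 'I_r, edge (path_src t i) (path_tgt t i)]
                       & (t ord_max : Lam A r) == nu]].

(** Strict dominance s ▷ t. *)
Definition path_gt (r : nat) (s t : vpath r) : bool :=
  [forall j, (t j <= s j)%O] && (s != t).

(** d_t = d_{t(r-1) -> t(r)} ... d_{t(0) -> t(1)}, computed in A_r. *)
Definition path_d (r : nat) (t : vpath r) : alg A r :=
  \prod_(i <- rev (enum 'I_r))
     incl (ltn_ord i) (bfac (path_src t i) (path_tgt t i)).

(** Representative m_nu d_t of the Murphy basis element
    m^nu_t = m_nu d_t + A_r^{▷ nu} of
    Δ_r(nu) = (m_nu A_r + A_r^{▷ nu}) / A_r^{▷ nu}; equality in Δ_r(nu) of such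
    cosets is [cell_eq nu]. *)
Definition murphy (r : nat) (nu : Lam A r) (t : vpath r) : alg A r :=
  cell_m nu * path_d t.

(** * Jucys-Murphy elements *)

Inductive JM_kind := JM_additive | JM_multiplicative.

(** The family is L_1, L_2, ...; the value [L 0] plays no role. *)
Definition JM_common (L : forall r, alg A r) : Prop :=
  (forall r, star (cel A r.+1) (L r.+1) = L r.+1) /\
  (forall r (a : alg A r), L r.+1 * inc A r a = inc A r a * L r.+1).

Definition acts_as_scalar (r : nat) (l : Lam A r) (a : alg A r) (k : R) : Prop :=
  forall x : Delta l, cell_act x a = k *: x.

Definition additive_JM (L : forall r, alg A r) (d : forall r, Lam A r -> R) :
    Prop :=
  [/\ JM_common L,
      forall r (l : Lam A r), (0 < r)%N ->
        acts_as_scalar l (\sum_(i < r) incl (ltn_ord i) (L i.+1)) (d r l)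
    & d 0 (Lam_root A) = 0].

Definition multiplicative_JM (L : forall r, alg A r)
    (d : forall r, Lam A r -> R) : Prop :=
  [/\ JM_common L,
      forall r, exists b : alg A r.+1, L r.+1 * b = 1 /\ b * L r.+1 = 1,
      forall r (l : Lam A r), (0 < r)%N ->
        acts_as_scalar l (\prod_(i < r) incl (ltn_ord i) (L i.+1)) (d r l)
    & d 0 (Lam_root A) = 1].

Definition JM_family (k : JM_kind) :=
  match k with
  | JM_additive => additive_JM
  | JM_multiplicative => multiplicative_JM
  end.

Definition kappa (k : JM_kind) (d : forall r, Lam A r -> R) (r : nat)
    (mu : Lam A r) (l : Lam A r.+1) : R :=
  match k with
  | JM_additive => d r.+1 l - d r mu
  | JM_multiplicative => d r.+1 l / d r mu
  end.

End Diagram.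

(* Main.v *)
Require Import Defs.
From mathcomp Require Import all_boot all_order all_algebra.

Set Implicit Arguments.
Unset Strict Implicit.
Unset Printing Implicit Defensive.

Import Order.TTheory GRing.Theory.
Local Open Scope ring_scope.

(** Triangularity comes from submodules of Δ_r(ν) that are visibly stable under
    every L_i and that the Murphy basis nevertheless detects.

    For a level j <= r and a set S of vertices of level j closed upwards for
    the dominance order, A_j^S, the span of the c^μ_{st} with μ in S, is a
    two-sided ideal of A_j.  Call x in Δ_r(ν) supported on S at level j if x is
    annihilated by all elements b of A_j such that A_j^S b = 0.  Such vectors
    form a submodule that is stable under A_j, because A_j^S is a right ideal,
    and under the centralizer of A_j.  Since L_i lies in A_j when i <= j and
    commutes with A_j when j < i, it preserves this submodule
    ([supported_JM]).

    The vectors supported on S are exactly the combinations of the m_t with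
    t(j) in S.  In one direction ([supported_mvec]), the compatibility
    m_λ d_{μ -> λ} = u^* m_μ, which holds in the algebra and not only in a
    quotient, gives a factorization m_ν d_t = u m_{t(j)} a with u in A_r and a
    in A_j ([murphy_factor]), where m_{t(j)} a lies in A_j^S.  In the other
    ([supported_coord]), go down the cell filtrations from A_r to A_j:
    isomorphisms of subquotients preserve supports, so it is enough to see that
    Δ_j(μ) has no nonzero vector supported on S when μ is not in S
    ([supported_out]).  This is where semisimplicity enters: over the field of
    fractions A_j^S is generated by a central idempotent e, which acts by 0 on
    Δ_j(μ), and a nonzero multiple of 1 - e that lies in A_j kills A_j^S but
    not the vector.

    Now m_t is supported on the elements above t(j), for every j at once.  So
    m_t L_i is too, and only paths s with s(j) above t(j) for all j contribute
    to it.  For the diagonal coefficient, the sum or product J_j of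
    L_1, ..., L_j acts on Δ_j(t(j)) by d(t(j)); by the same factorization
    m_t J_j is d(t(j)) m_t up to a vector supported strictly above t(j), whose
    coefficient at t is 0 ([JM_total_mvec]).  Comparing J_i with J_{i-1} yields
    κ_t(i) ([JM_coef]). *)

(** * Coordinates in a basis *)

Section Coordinates.
Variables (R : nzRingType) (V : lmodType R) (I : finType).
Variables (b : I -> V) (bP : is_basis b).

Lemma basis_coordK v : v = \sum_i basis_coord bP v i *: b i.
Proof. exact/eqP/(xchooseP (basis_coord_ex bP v)). Qed.

Lemma basis_coord_unique v (f : I -> R) :
  v = \sum_i f i *: b i -> forall i, basis_coord bP v i = f i.
Proof.
move=> vE i; have [g [_ gU]] := bP v.
rewrite -(gU _ (basis_coordK v)) (gU (finfun f)) ?ffunE // vE.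
by apply: eq_bigr => j _; rewrite ffunE.
Qed.

Lemma basis_coordD u v i :
  basis_coord bP (u + v) i = basis_coord bP u i + basis_coord bP v i.
Proof.
apply: (basis_coord_unique (f := fun i => basis_coord bP u i + basis_coord bP v i)).
rewrite {1}(basis_coordK u) {1}(basis_coordK v) -big_split /=.
by apply: eq_bigr => j _; rewrite scalerDl.
Qed.

Lemma basis_coordZ k v i : basis_coord bP (k *: v) i = k * basis_coord bP v i.
Proof.
apply: (basis_coord_unique (f := fun i => k * basis_coord bP v i)).
rewrite {1}(basis_coordK v) scaler_sumr.
by apply: eq_bigr => j _; rewrite scalerA.
Qed.

Lemma basis_coord0 i : basis_coord bP 0 i = 0.
Proof. by have := basis_coordZ 0 0 i; rewrite scale0r mul0r. Qed.

Lemma basis_coord_sum (J : Type) (s : seq J) (P : pred J) (F : J -> V) i :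
  basis_coord bP (\sum_(j <- s | P j) F j) i
    = \sum_(j <- s | P j) basis_coord bP (F j) i.
Proof.
by apply: (big_morph (fun v => basis_coord bP v i) (fun u v => basis_coordD u v i));
  rewrite basis_coord0.
Qed.

Lemma basis_coord_id i j : basis_coord bP (b i) j = (j == i)%:R.
Proof.
apply: (basis_coord_unique (f := fun j => (j == i)%:R)).
rewrite (bigD1 i) //= eqxx scale1r big1 ?addr0 // => l /negbTE ->.
by rewrite scale0r.
Qed.

Lemma in_spanP (P : pred I) v :
  in_span b P v <-> forall i, ~~ P i -> basis_coord bP v i = 0.
Proof.
split=> [[f ->] i nPi | v0].
  rewrite basis_coord_sum big1 // => j Pj; rewrite basis_coordZ basis_coord_id.
  by case: eqP nPi => [->|]; rewrite ?Pj ?mulr0.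
exists (basis_coord bP v); rewrite {1}(basis_coordK v) (bigID P) /=.
by rewrite [X in _ + X]big1 ?addr0 // => i /v0 ->; rewrite scale0r.
Qed.

End Coordinates.

Section Spans.
Variables (R : nzRingType) (V : lmodType R) (I : finType) (b : I -> V).
Variable (P : pred I).

Lemma in_span_basis i : P i -> in_span b P (b i).
Proof.
move=> Pi; exists (fun j => (j == i)%:R).
rewrite (bigD1 i) //= eqxx scale1r big1 ?addr0 // => l /andP[_ /negbTE ->].
by rewrite scale0r.
Qed.

Lemma in_spanD u v : in_span b P u -> in_span b P v -> in_span b P (u + v).
Proof.
move=> [f ->] [g ->]; exists (fun i => f i + g i).
by rewrite -big_split /=; apply: eq_bigr => i _; rewrite scalerDl.
Qed.

Lemma in_spanZ k v : in_span b P v -> in_span b P (k *: v).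
Proof.
move=> [f ->]; exists (fun i => k * f i).
by rewrite scaler_sumr; apply: eq_bigr => i _; rewrite scalerA.
Qed.

Lemma in_span0 : in_span b P 0.
Proof. by exists (fun=> 0); rewrite big1 // => i _; rewrite scale0r. Qed.

Lemma in_span_sum (J : Type) (s : seq J) (Q : pred J) (F : J -> V) :
  (forall j, Q j -> in_span b P (F j)) ->
  in_span b P (\sum_(j <- s | Q j) F j).
Proof.
move=> FP; elim/big_rec: _ => [|j v Qj vP]; first exact: in_span0.
exact: in_spanD (FP _ Qj) vP.
Qed.

Lemma in_span_ind (Q : V -> Prop) :
  Q 0 -> (forall u v, Q u -> Q v -> Q (u + v)) ->
  (forall k v, Q v -> Q (k *: v)) -> (forall i, P i -> Q (b i)) ->
  forall v, in_span b P v -> Q v.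
Proof.
move=> Q0 QD QZ Qb v [f ->]; elim/big_rec: _ => [//|i u Pi Qu].
by apply: QD => //; apply/QZ/Qb.
Qed.

End Spans.

Lemma in_span_sub (R : nzRingType) (V : lmodType R) (I : finType) (b : I -> V)
    (P Q : pred I) v : subpred P Q -> in_span b P v -> in_span b Q v.
Proof.
move=> sPQ; apply: in_span_ind; [exact: in_span0 | exact: in_spanD | |].
  exact: in_spanZ.
by move=> i /sPQ; apply: in_span_basis.
Qed.

(** * Cell ideals and cell modules *)

Section CellIdeals.
Variables (R : idomainType) (A : algType R) (C : cellular A).
Implicit Types (S : pred (cell_idx C)) (l : cell_idx C) (a y : A).

Local Notation cc := (basis_coord (cbas_famP C)).

Definition cell_ideal S : A -> Prop :=
  in_span (@cbas_fam R A C) (fun i => S (tag i)).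

Definition up_closed S := forall l m, (l <= m)%O -> S l -> S m.

Definition cbas_index l (s t : cell_tab l) : cbas_ind C :=
  @Tagged _ l (fun l' => (cell_tab l' * cell_tab l')%type) (s, t).

Lemma up_closed_ge l : up_closed (fun m => (l <= m)%O).
Proof. by move=> m n mn lm; apply: le_trans lm mn. Qed.

Lemma up_closed_gt l : up_closed (fun m => (l < m)%O).
Proof. by move=> m n mn lm; apply: lt_le_trans lm mn. Qed.

Lemma cell_gt_ideal S l a : up_closed S -> S l -> cell_gt l a -> cell_ideal S a.
Proof. by move=> Su Sl; apply: in_span_sub => i /ltW li; apply: Su li Sl. Qed.

Lemma cbas_ideal S l (s t : cell_tab l) : S l -> cell_ideal S (cbas s t).
Proof. exact: (@in_span_basis _ _ _ _ _ (cbas_index s t)). Qed.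

Lemma cell_ideal_mulr S y a :
  up_closed S -> cell_ideal S y -> cell_ideal S (y * a).
Proof.
move=> Su; move: y; apply: in_span_ind => [|u v|k v|].
- by rewrite mul0r; apply: in_span0.
- by rewrite mulrDl; apply: in_spanD.
- by rewrite -scalerAl; apply: in_spanZ.
move=> [l [s t]] /= Sl; have := cbas_mul t a s.
move=> /(cell_gt_ideal Su Sl) mem.
rewrite /cbas_fam /= -[X in cell_ideal _ X](subrK (\sum_v cell_coef a t v *: cbas s v)).
apply: in_spanD mem _; apply: in_span_sum => v _; apply: in_spanZ.
exact: cbas_ideal.
Qed.

Lemma starD a y : star C (a + y) = star C a + star C y.
Proof. by have := star_linear C 1 a y; rewrite !scale1r. Qed.

Lemma star0 : star C 0 = 0.
Proof. by apply: (addrI (star C 0)); rewrite -starD !addr0. Qed.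

Lemma starZ k a : star C (k *: a) = k *: star C a.
Proof. by have := star_linear C k a 0; rewrite !addr0 star0 addr0. Qed.

Lemma cell_ideal_star S y :
  up_closed S -> cell_ideal S y -> cell_ideal S (star C y).
Proof.
move=> Su; move: y; apply: in_span_ind => [|u v|k v|].
- by rewrite star0; apply: in_span0.
- by rewrite starD; apply: in_spanD.
- by rewrite starZ; apply: in_spanZ.
move=> [l [s t]] /= Sl; have /(cell_gt_ideal Su Sl) mem := cbas_star s t.
rewrite /cbas_fam /= -[X in cell_ideal _ X](subrK (cbas t s)).
by apply: in_spanD mem _; apply: cbas_ideal.
Qed.

(** The cellular axioms describe right multiplication only; the involution,
    which preserves the ideal, exchanges the two sides. *)
Lemma cell_ideal_mull S y a :
  up_closed S -> cell_ideal S y -> cell_ideal S (a * y).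
Proof.
move=> Su Sy; rewrite -[a * y](starK C) starM; apply: cell_ideal_star => //.
exact: cell_ideal_mulr (cell_ideal_star _ _).
Qed.

(** Under α_l, the quotient A^{⊵ l} / A^{▷ l} becomes a direct sum of copies of
    the right module Δ(l), indexed by [s]; this is the component of [y] in the
    copy of index [s].  It reduces the module axioms for Δ(l), which are opaque
    in terms of structure constants, to the ring axioms of A. *)
Definition cell_row l (s : cell_tab l) y : cell_module l :=
  [ffun t => cc y (cbas_index s t)].

Lemma cell_rowD l (s : cell_tab l) y z :
  cell_row s (y + z) = cell_row s y + cell_row s z.
Proof. by apply/ffunP => t; rewrite !ffunE basis_coordD. Qed.

Lemma cell_rowZ l (s : cell_tab l) k y : cell_row s (k *: y) = k *: cell_row s y.
Proof. by apply/ffunP => t; rewrite !ffunE basis_coordZ. Qed.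

Lemma cell_row_out S l (s : cell_tab l) y :
  ~~ S l -> cell_ideal S y -> cell_row s y = 0.
Proof.
move=> nSl /(in_spanP (cbas_famP C)) y0; apply/ffunP => t.
by rewrite !ffunE y0.
Qed.

Lemma cell_row_gt l (s : cell_tab l) y : cell_gt l y -> cell_row s y = 0.
Proof. by apply: (cell_row_out (S := fun m => (l < m)%O)); rewrite ltxx. Qed.

Lemma cell_actDl l (x y : cell_module l) a :
  cell_act (x + y) a = cell_act x a + cell_act y a.
Proof.
apply/ffunP => v; rewrite !ffunE -big_split /=.
by apply: eq_bigr => t _; rewrite ffunE mulrDl.
Qed.

Lemma cell_actZl l k (x : cell_module l) a :
  cell_act (k *: x) a = k *: cell_act x a.
Proof.
apply/ffunP => v; rewrite !ffunE scaler_sumr.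
by apply: eq_bigr => t _; rewrite ffunE -mulrA.
Qed.

Lemma cell_act0l l a : cell_act (0 : cell_module l) a = 0.
Proof. by have := cell_actZl 0 (0 : cell_module l) a; rewrite !scale0r. Qed.

Lemma cbas_index_eq l (s t s' t' : cell_tab l) :
  (cbas_index s t == cbas_index s' t') = (s == s') && (t == t').
Proof. by rewrite /cbas_index eq_Tagged /= xpair_eqE. Qed.

Lemma cell_row_cbas l (s s' t : cell_tab l) :
  cell_row s (cbas s' t) = [ffun v => ((s == s') && (v == t))%:R].
Proof.
apply/ffunP => v; rewrite !ffunE.
by rewrite (basis_coord_id (cbas_famP C) (cbas_index s' t)) cbas_index_eq.
Qed.

Lemma cell_row_mul l (s : cell_tab l) y a :
  cell_ge l y -> cell_row s (y * a) = cell_act (cell_row s y) a.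
Proof.
move: y; apply: in_span_ind => [|u v|k v|].
- have := cell_rowZ s 0 0; rewrite !scale0r mul0r => ->.
  by rewrite cell_act0l.
- by rewrite mulrDl !cell_rowD cell_actDl => -> ->.
- by rewrite -scalerAl !cell_rowZ cell_actZl => ->.
move=> [m [s' t]] /=; rewrite le_eqVlt => /orP[/eqP lm | lm].
  move: s s' t; case: m / lm => s s' t.
  have /(cell_row_gt s) := cbas_mul t a s'.
  rewrite /cbas_fam /= cell_rowD -scaleN1r cell_rowZ scaleN1r => /eqP.
  rewrite subr_eq0 => /eqP ->; apply/ffunP => v; rewrite !ffunE basis_coord_sum.
  transitivity ((s == s')%:R * cell_coef a t v).
    rewrite (bigD1 v) //= basis_coordZ (basis_coord_id _ (cbas_index s' v)).
    rewrite cbas_index_eq eqxx andbT.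
    rewrite mulrC big1 ?addr0 // => w wv; rewrite basis_coordZ.
    by rewrite (basis_coord_id _ (cbas_index s' w)) cbas_index_eq [v == w]eq_sym (negbTE wv)
               andbF mulr0.
  rewrite cell_row_cbas (bigD1 t) //= !ffunE eqxx andbT big1 ?addr0 // => w wt.
  by rewrite ffunE (negbTE wt) andbF mul0r.
have mem : cell_gt l (@cbas_fam _ _ C (existT _ m (s', t))).
  exact: cbas_ideal.
rewrite (cell_row_gt s mem) cell_act0l cell_row_gt //.
by apply: cell_ideal_mulr mem; apply: up_closed_gt.
Qed.

(** Together with [cell_row_mul], this transfers identities of A to the action
    on Δ(l). *)
Lemma cell_row_surj l (s : cell_tab l) (x : cell_module l) :
  exists2 y, cell_ge l y & cell_row s y = x.
Proof.
exists (\sum_t (x t : R) *: cbas s t).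
  by apply: in_span_sum => t _; apply/in_spanZ/cbas_ideal.
apply/ffunP => v; rewrite ffunE basis_coord_sum (bigD1 v) //= basis_coordZ.
rewrite (basis_coord_id _ (cbas_index s v)) eqxx mulr1 big1 ?addr0 // => w wv.
by rewrite basis_coordZ (basis_coord_id _ (cbas_index s w)) cbas_index_eq [v == w]eq_sym
           (negbTE wv) andbF mulr0.
Qed.

(** [cell_row] needs an index [s]; when there is none, Δ(l) is zero. *)
Lemma cell_module_cases l (P : Prop) (x : cell_module l) :
  (x = 0 -> P) -> (cell_tab l -> P) -> P.
Proof.
move=> P0 Pt; case: (pickP (cell_tab l)) => [t _ | no]; first exact: Pt.
by apply: P0; apply/ffunP => t; have := no t.
Qed.

Lemma cell_actM l (x : cell_module l) a b :
  cell_act x (a * b) = cell_act (cell_act x a) b.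
Proof.
apply: (cell_module_cases (x := x)) => [-> | s]; first by rewrite !cell_act0l.
have [y ly <-] := cell_row_surj s x.
by rewrite -!cell_row_mul ?mulrA //; apply: cell_ideal_mulr ly; apply: up_closed_ge.
Qed.

Lemma cell_act1 l (x : cell_module l) : cell_act x 1 = x.
Proof.
apply: (cell_module_cases (x := x)) => [-> | s]; first by rewrite !cell_act0l.
by have [y ly <-] := cell_row_surj s x; rewrite -cell_row_mul ?mulr1.
Qed.

Lemma cell_actDr l (x : cell_module l) a b :
  cell_act x (a + b) = cell_act x a + cell_act x b.
Proof.
apply: (cell_module_cases (x := x)) => [-> | s]; first by rewrite !cell_act0l addr0.
have [y ly <-] := cell_row_surj s x.
by rewrite -!cell_row_mul // mulrDr cell_rowD.
Qed.

Lemma cell_actZr l (x : cell_module l) k a :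
  cell_act x (k *: a) = k *: cell_act x a.
Proof.
apply: (cell_module_cases (x := x)) => [-> | s].
  by rewrite !cell_act0l scaler0.
have [y ly <-] := cell_row_surj s x.
by rewrite -!cell_row_mul // -scalerAr cell_rowZ.
Qed.

Lemma cell_act0r l (x : cell_module l) : cell_act x 0 = 0.
Proof. by have := cell_actZr x 0 0; rewrite !scale0r. Qed.

Lemma cell_actBr l (x : cell_module l) a b :
  cell_act x (a - b) = cell_act x a - cell_act x b.
Proof. by rewrite cell_actDr -(scaleN1r b) cell_actZr scaleN1r. Qed.

Lemma cell_act_sumr l (x : cell_module l) (J : Type) (s : seq J) (P : pred J)
    (F : J -> A) :
  cell_act x (\sum_(j <- s | P j) F j) = \sum_(j <- s | P j) cell_act x (F j).
Proof.
elim/big_rec2: _ => [|j y z Pj <-]; first exact: cell_act0r.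
exact: cell_actDr.
Qed.

Lemma cell_gt_row l y :
  cell_ge l y -> (forall s : cell_tab l, cell_row s y = 0) -> cell_gt l y.
Proof.
move=> /(in_spanP (cbas_famP C)) y0 row0; apply/(in_spanP (cbas_famP C)).
move=> [m [s t]] /= nlm.
have [lm|nl] := boolP (l <= m)%O; last exact: y0.
move: lm; rewrite le_eqVlt (negbTE nlm) orbF => /eqP lm.
move: s t {nlm}; case: m / lm => s t.
by have /ffunP/(_ t) := row0 s; rewrite !ffunE.
Qed.

(** A^{⊵ l} / A^{▷ l} is a sum of copies of Δ(l) as a right module, so a scalar
    action on the latter is a scalar action on the former. *)
Lemma cell_ge_scalar l y a k :
  cell_ge l y -> (forall x : cell_module l, cell_act x a = k *: x) ->
  cell_gt l (y * a - k *: y).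
Proof.
move=> ly ak; apply: cell_gt_row => [|s].
  rewrite -scaleNr; apply: in_spanD; last exact: in_spanZ.
  by apply: cell_ideal_mulr ly; apply: up_closed_ge.
by rewrite -scaleNr cell_rowD cell_rowZ cell_row_mul // ak scaleNr subrr.
Qed.

(** The product c^l_{st} y lies in the two-sided ideal spanned by [S], which has
    no component along the c^l_{sv}. *)
Lemma cell_act_ideal S l (x : cell_module l) y :
  up_closed S -> ~~ S l -> cell_ideal S y -> cell_act x y = 0.
Proof.
move=> Su nSl Sy; apply: (cell_module_cases (x := x)) => [-> | s].
  by rewrite cell_act0l.
have [z lz <-] := cell_row_surj s x; rewrite -cell_row_mul //.
exact: cell_row_out nSl (cell_ideal_mull _ Su Sy).
Qed.

End CellIdeals.

(** * Ideals of split semisimple algebras *)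

Section SplitSemisimple.
Variables (K : fieldType) (B : algType K).
Variables (l : nat) (n : 'I_l -> nat).
Variables (pi : forall i : 'I_l, {lrmorphism B -> 'M[K]_((n i).+1)}).
Hypothesis piP : forall y : (forall i : 'I_l, 'M[K]_((n i).+1)),
  exists! x : B, forall i, pi i x = y i.

Variable Q : B -> Prop.
Hypotheses (Q0 : Q 0) (QD : forall x y, Q x -> Q y -> Q (x + y))
  (Ql : forall a x, Q x -> Q (a * x)) (Qr : forall a x, Q x -> Q (x * a)).

Lemma block_inj x y : (forall i, pi i x = pi i y) -> x = y.
Proof.
move=> xy; have [z [_ zU]] := piP (fun i => pi i y).
by rewrite -(zU x) // -(zU y).
Qed.

Lemma block_lift (y : forall i : 'I_l, 'M[K]_((n i).+1)) :
  exists x, forall i, pi i x = y i.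
Proof. by have [x [xy _]] := piP y; exists x. Qed.

Lemma block_delta i (p q : 'I_(n i).+1) :
  exists x, pi i x = delta_mx p q /\ forall j, j != i -> pi j x = 0.
Proof.
(* Comparing indices as natural numbers describes the family of matrices for
   all blocks at once, without transport along [j = i]. *)
have [x xP] := block_lift (fun j => \matrix_(a, b)
  [&& j == i, val a == val p & val b == val q]%:R).
exists x; split=> [|j /negbTE ji]; rewrite xP; apply/matrixP => a b.
  by rewrite !mxE eqxx.
by rewrite !mxE ji.
Qed.

(** If x in the ideal has x_{pq} <> 0 in block [i], then the sum over c of
    x_{pq}^-1 E_{cp} x E_{qc} is the identity of that block. *)
Lemma ideal_block_unit i x :
  Q x -> pi i x != 0 -> exists2 e, Q e & forall j, pi j e = (j == i)%:R.
Proof.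
move=> Qx /matrix0Pn [p [q pq0]].
have [X XP] := fin_all_exists (fun c => block_delta c p).
have [Y YP] := fin_all_exists (fun c => block_delta q c).
exists (\sum_c ((pi i x p q)^-1 *: X c) * x * Y c).
  by elim/big_rec: _ => // c e _ Qe; apply/QD/Qe/Qr/Ql.
move=> j; rewrite rmorph_sum /=; case: (altP (j =P i)) => [-> | ji]; last first.
  rewrite big1 // => c _; rewrite !rmorphM /= linearZ /=.
  by rewrite (XP c).2 // scaler0 !mul0r.
rewrite -[RHS]/(1%:M) mx1_sum_delta; apply: eq_bigr => c _.
rewrite !rmorphM /= linearZ /= (XP c).1 (YP c).1.
apply/matrixP => a b; rewrite -!scalerAl !mxE.
rewrite (bigD1 q) //= big1 => [|r /negbTE rq]; last by rewrite !mxE rq mulr0.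
rewrite !mxE (bigD1 p) //= big1 => [|r /negbTE rp]; last first.
  by rewrite !mxE rp andbF mul0r.
rewrite !mxE !eqxx !addr0 andbT /=.
by case: (a == c); case: (b == c); rewrite ?(mulr0, mul0r, mulr1, mul1r) ?mulVf.
Qed.

End SplitSemisimple.

(** The ideal is the product of the blocks on which it does not vanish, so its
    identity element is the sum of the identities of these blocks. *)
Lemma split_semisimple_ideal_unit (K : fieldType) (B : algType K) (I : finType)
    (b : I -> B) (P : pred I) :
  split_semisimple B ->
  (forall a x, in_span b P x -> in_span b P (a * x)) ->
  (forall a x, in_span b P x -> in_span b P (x * a)) ->
  exists2 e, in_span b P e & forall x, in_span b P x -> x * e = x.
Proof.
move=> [l [n [pi piP]]] Ql Qr.
pose J i := [exists k, P k && (pi i (b k) != 0)].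
have [u uP] : exists u : 'I_l -> B, forall i, J i ->
    in_span b P (u i) /\ forall j, pi j (u i) = (j == i)%:R.
  suff /fin_all_exists [u uP] : forall i, exists u : B, J i ->
    in_span b P u /\ forall j, pi j u = (j == i)%:R by exists u.
  move=> i; case: (boolP (J i)) => [/existsP[k /andP[Pk bk0]] | _]; last by exists 0.
  have [e Qe eP] := ideal_block_unit piP (@in_span0 _ _ _ b P)
    (@in_spanD _ _ _ b P) Ql Qr (in_span_basis b Pk) bk0.
  by exists e.
have pi_sum i : pi i (\sum_(j | J j) u j) = (J i)%:R.
  rewrite rmorph_sum /=; case: (boolP (J i)) => [Ji | nJi].
    rewrite (bigD1 i) //= (uP i Ji).2 eqxx big1 ?addr0 // => j /andP[Jj ji].
    by rewrite (uP j Jj).2 eq_sym (negbTE ji).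
  rewrite big1 // => j Jj; rewrite (uP j Jj).2.
  by case: eqP Jj nJi => [->|//] ->.
exists (\sum_(i | J i) u i).
  by apply: in_span_sum => i Ji; case: (uP i Ji).
move=> x Px; apply: (block_inj piP) => i; rewrite rmorphM /= pi_sum.
case: (boolP (J i)) => [_ | nJi]; first by rewrite mulr1.
rewrite mulr0; apply/esym; move: x Px; apply: in_span_ind => [|y z yP zP|k y yP|k Pk].
- by rewrite rmorph0.
- by rewrite rmorphD /= yP zP addr0.
- by rewrite linearZ /= yP scaler0.
by apply/eqP; apply: contraR nJi => bk0; apply/existsP; exists k; rewrite Pk.
Qed.

(** * Scalar extension to the field of fractions *)

Section FractionField.
Variable R : idomainType.

Lemma frac_num_den (x : {fraction R}) :
  exists k p : R, k != 0 /\ FracField.tofrac k * x = FracField.tofrac p.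
Proof.
elim/quotW: x => x; exists (frac x).2, (frac x).1; split.
  exact: denom_ratioP.
unlock FracField.tofrac; rewrite -[LHS]FracField.pi_mul.
apply/eqmodP; rewrite /= FracField.equivfE /FracField.mulf.
by rewrite !numden_Ratio ?(oner_neq0, mul1r, mulr1) ?denom_ratioP // mulrC.
Qed.

Lemma common_denominator (I : finType) (f : I -> {fraction R}) :
  exists k : R, exists g : I -> R,
    k != 0 /\ forall i, FracField.tofrac k * f i = FracField.tofrac (g i).
Proof.
have [k /fin_all_exists [g kg]] := fin_all_exists (fun i => frac_num_den (f i)).
exists (\prod_i k i), (fun i => g i * \prod_(j | j != i) k j).
split=> [|i]; first by apply/prodf_neq0 => i _; case: (kg i).
by rewrite (bigD1 i) //= rmorphM rmorphM /= -(kg i).2 mulrAC.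
Qed.

End FractionField.

Section CellIdealUnit.
Variables (R : idomainType) (A : algType R) (C : cellular A).
Variables (B : algType {fraction R}) (phi : {rmorphism A -> B}).
Hypothesis phiP : is_scalar_extension (@cbas_fam R A C) phi.

Lemma scalar_extension_inj : injective phi.
Proof.
case: phiP => phiZ bP x y xy; apply/eqP; rewrite -subr_eq0; apply/eqP.
have {xy} : phi (x - y) = 0 by rewrite rmorphB xy subrr.
rewrite (basis_coordK (cbas_famP C) (x - y)); set f := basis_coord _ _.
rewrite rmorph_sum /= => f0; apply: big1 => i _.
have/esym := basis_coord0 bP i; rewrite -f0.
rewrite (@basis_coord_unique _ _ _ _ bP _ (fun i => FracField.tofrac (f i))) //; last first.
  by apply: eq_bigr => j _; rewrite phiZ.
by move/esym/eqP; rewrite tofrac_eq0 => /eqP ->; rewrite scale0r.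
Qed.

(** In the semisimple algebra A ⊗ F the ideal spanned by A^S has an identity
    element; clearing denominators brings a multiple of it into A^S. *)
Lemma cell_ideal_unit S :
  split_semisimple B -> up_closed S ->
  exists e, exists k : R, [/\ k != 0, cell_ideal (C := C) S e
    & forall y, cell_ideal (C := C) S y -> y * e = k *: y].
Proof.
move=> ssB Su; case: (phiP) => phiZ bP.
pose P := fun i : cbas_ind C => S (tag i).
have phi_ideal y : cell_ideal S y -> in_span (fun i => phi (cbas_fam i)) P (phi y).
  move: y; apply: in_span_ind => [|u v|k v|i Pi].
  - by rewrite rmorph0; apply: in_span0.
  - by rewrite rmorphD; apply: in_spanD.
  - by rewrite phiZ; apply: in_spanZ.
  exact: (in_span_basis (fun i => phi (cbas_fam i))).
have [||e [f eE] eid] := split_semisimple_ideal_unit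
  (b := fun i => phi (cbas_fam i)) (P := P) ssB.
- move=> a; apply: in_span_ind => [|u v|k v|i Pi].
  + by rewrite mulr0; apply: in_span0.
  + by rewrite mulrDr; apply: in_spanD.
  + by rewrite -scalerAr; apply: in_spanZ.
  rewrite (basis_coordK bP a) mulr_suml; apply: in_span_sum => j _.
  rewrite -scalerAl -rmorphM; apply/in_spanZ/phi_ideal/cell_ideal_mull => //.
  exact: in_span_basis.
- move=> a; apply: in_span_ind => [|u v|k v|i Pi].
  + by rewrite mul0r; apply: in_span0.
  + by rewrite mulrDl; apply: in_spanD.
  + by rewrite -scalerAl; apply: in_spanZ.
  rewrite (basis_coordK bP a) mulr_sumr; apply: in_span_sum => j _.
  rewrite -scalerAr -rmorphM; apply/in_spanZ/phi_ideal/cell_ideal_mulr => //.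
  exact: in_span_basis.
have [k [g [k0 kg]]] := common_denominator f.
exists (\sum_(i | P i) g i *: cbas_fam i), k; split=> // [|y Sy].
  by exists g.
apply: scalar_extension_inj; rewrite rmorphM /= phiZ rmorph_sum /=.
rewrite -[in RHS](eid _ (phi_ideal _ Sy)) scalerAr; congr (_ * _).
rewrite eE scaler_sumr; apply: eq_bigr => i _.
by rewrite phiZ -kg scalerA.
Qed.

(** If e is an identity element of A^S up to the scalar k, take b = k - e.  This
    is how semisimplicity separates Δ(l) from the ideals A^S with [l] outside
    S. *)
Lemma cell_ideal_annihilator S (l : cell_idx C) :
  split_semisimple B -> up_closed S -> ~~ S l ->
  exists b, exists k : R, [/\ k != 0,
    forall y, cell_ideal (C := C) S y -> y * b = 0
    & forall x : cell_module l, cell_act x b = k *: x].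
Proof.
move=> ssB Su nSl; have [e [k [k0 Se ek]]] := cell_ideal_unit ssB Su.
exists (k%:A - e), k; split=> // [y Sy | x].
  by rewrite mulrBr -scalerAr mulr1 ek ?subrr.
by rewrite cell_actBr cell_actZr cell_act1 (cell_act_ideal _ Su nSl Se) subr0.
Qed.

End CellIdealUnit.

(** * Inclusions in the tower *)

Section Inclusions.
Variables (R : idomainType) (A : cell_tower R).

Lemma leq_exists_add i r : (i <= r)%N -> exists k, (k + i)%N = r.
Proof. by move=> le_ir; exists (r - i)%N; apply: subnK. Qed.

Lemma inclE k i r (e : (k + i)%N = r) (le_ir : (i <= r)%N) (a : alg A i) :
  incl le_ir a = ecast n (alg A n) e (incl_add k a).
Proof.
have ek : (r - i)%N = k by rewrite -e addnK.
rewrite /incl; move: (subnK le_ir); rewrite ek => e'.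
by rewrite (eq_irrelevance e' e).
Qed.

Lemma incl_id r (le_rr : (r <= r)%N) (a : alg A r) : incl le_rr a = a.
Proof. exact: (inclE (k := 0) erefl). Qed.

Lemma inclS i r (le_ir : (i <= r)%N) (le_irS : (i <= r.+1)%N) (a : alg A i) :
  incl le_irS a = inc A r (incl le_ir a).
Proof.
have [k e] := leq_exists_add le_ir.
by rewrite (inclE e) (inclE (k := k.+1) (congr1 S e)); case: r / e le_ir le_irS.
Qed.

Lemma incl_linear i r (le_ir : (i <= r)%N) k (a b : alg A i) :
  incl le_ir (k *: a + b) = k *: incl le_ir a + incl le_ir b.
Proof.
have [k' e] := leq_exists_add le_ir; rewrite !(inclE e); case: r / e le_ir => _ /=.
by elim: k' => //= n ->; rewrite linearP.
Qed.

Lemma incl_mul i r (le_ir : (i <= r)%N) (a b : alg A i) :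
  incl le_ir (a * b) = incl le_ir a * incl le_ir b.
Proof.
have [k' e] := leq_exists_add le_ir; rewrite !(inclE e); case: r / e le_ir => _ /=.
by elim: k' => //= n ->; rewrite rmorphM.
Qed.

Lemma incl_1 i r (le_ir : (i <= r)%N) : incl le_ir (1 : alg A i) = 1.
Proof.
have [k e] := leq_exists_add le_ir; rewrite (inclE e); case: r / e le_ir => _ /=.
by elim: k => //= n ->; rewrite rmorph1.
Qed.

Lemma incl_D i r (le_ir : (i <= r)%N) (a b : alg A i) :
  incl le_ir (a + b) = incl le_ir a + incl le_ir b.
Proof. by have := incl_linear le_ir 1 a b; rewrite !scale1r. Qed.

Lemma incl_0 i r (le_ir : (i <= r)%N) : incl le_ir (0 : alg A i) = 0.
Proof. by apply: (addrI (incl le_ir 0)); rewrite -incl_D !addr0. Qed.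

Lemma incl_Z i r (le_ir : (i <= r)%N) k (a : alg A i) :
  incl le_ir (k *: a) = k *: incl le_ir a.
Proof. by have := incl_linear le_ir k a 0; rewrite incl_0 !addr0. Qed.

Lemma incl_B i r (le_ir : (i <= r)%N) (a b : alg A i) :
  incl le_ir (a - b) = incl le_ir a - incl le_ir b.
Proof. by rewrite incl_D -(scaleN1r b) incl_Z scaleN1r. Qed.

Lemma incl_trans i j r (le_ij : (i <= j)%N) (le_jr : (j <= r)%N)
    (le_ir : (i <= r)%N) (a : alg A i) :
  incl le_jr (incl le_ij a) = incl le_ir a.
Proof.
elim: r le_jr le_ir => [|r IHr] le_jr le_ir.
  case: j le_ij le_jr => // le_ij le_jr.
  by rewrite incl_id (eq_irrelevance le_ij le_ir).
have /orP[/eqP ejr | lt_jr] : (j == r.+1) || (j <= r)%N by rewrite -leq_eqVlt.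
  subst j; by rewrite incl_id (eq_irrelevance le_ij le_ir).
rewrite (inclS lt_jr) (IHr _ (leq_trans le_ij lt_jr)).
by rewrite -(inclS _ le_ir).
Qed.

Lemma inc_incl i r (le_ir : (i <= r)%N) (lt_ir : (i < r)%N) (a : alg A i) :
  incl lt_ir (inc A i a) = incl le_ir a.
Proof.
by rewrite -(incl_trans (leqnSn i) lt_ir) (inclS (leqnn i)) incl_id.
Qed.

End Inclusions.

(** * Paths in the branching diagram *)

Section Paths.
Variables (R : idomainType) (A : diagram_data R).

(** The vertex of a path at level [n], with the bound on [n] as an argument so
    that its type is [Lam A n] on the nose. *)
Definition vert r (t : vpath A r) n (le_nr : (n <= r)%N) : Lam A n :=
  t (Ordinal (le_nr : (n < r.+1)%N)).

Lemma vertE r (t : vpath A r) n (lt_nr : (n < r.+1)%N) (le_nr : (n <= r)%N) :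
  t (Ordinal lt_nr) = vert t le_nr :> Lam A n.
Proof. by rewrite /vert (eq_irrelevance lt_nr le_nr). Qed.

Lemma vpath_ext r (s t : vpath A r) :
  (forall n (le_nr : (n <= r)%N), vert s le_nr = vert t le_nr) -> s = t.
Proof. by move=> st; apply/ffunP => -[n lt_nr]; apply: st. Qed.

Lemma path_srcE r (t : vpath A r) n (lt_nr : (n < r)%N) (le_nr : (n <= r)%N) :
  path_src t (Ordinal lt_nr) = vert t le_nr.
Proof. exact: vertE. Qed.

Lemma path_tgtE r (t : vpath A r) n (lt_nr : (n < r)%N) :
  path_tgt t (Ordinal lt_nr) = vert t lt_nr.
Proof. exact: (@vertE r t n.+1). Qed.

Lemma StdP r (nu : Lam A r) (t : vpath A r) :
  t \in Std nu <->
  [/\ vert t (leq0n r) = Lam_root A,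
      forall n (lt_nr : (n < r)%N) (le_nr : (n <= r)%N),
        edge (vert t le_nr) (vert t lt_nr)
    & vert t (leqnn r) = nu].
Proof.
rewrite inE; split.
  case/and3P=> /eqP t0 /forallP te /eqP tr; split.
  - by rewrite -[RHS]t0; apply/esym/(@vertE r t 0).
  - by move=> n lt_nr le_nr; rewrite -(path_srcE t lt_nr) -path_tgtE; exact: (te (Ordinal lt_nr)).
  - by rewrite -[RHS]tr; apply/esym/(@vertE r t r).
case=> t0 te tr; apply/and3P; split.
- by apply/eqP; rewrite -[RHS]t0; apply: (@vertE r t 0).
- apply/forallP => -[n lt_nr].
  by rewrite (path_srcE _ _ (ltnW lt_nr)) path_tgtE.
- by apply/eqP; rewrite -[RHS]tr; apply: (@vertE r t r).
Qed.

Definition path_trunc r (t : vpath A r.+1) : vpath A r :=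
  [ffun i : 'I_r.+1 => t (widen_ord (leqnSn r.+1) i)].

Lemma vert_trunc r (t : vpath A r.+1) n (le_nr : (n <= r)%N)
    (le_nrS : (n <= r.+1)%N) :
  vert (path_trunc t) le_nr = vert t le_nrS.
Proof. by rewrite {1}/vert ffunE; apply: vertE. Qed.

Definition extend_vert r (s : vpath A r) (nu : Lam A r.+1) (i : 'I_r.+2) :
    Lam A i :=
  match decP (@idP (i < r.+1)%N) with
  | left lt_ir => s (Ordinal lt_ir)
  | right nlt_ir =>
      ecast n (Lam A n)
        (esym (anti_leq (introT andP (conj (ltn_ord i : (i <= r.+1)%N)
           (eqbRL (leqNgt _ _) (introN idP nlt_ir)))))) nu
  end.

Definition path_extend r (s : vpath A r) (nu : Lam A r.+1) : vpath A r.+1 :=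
  [ffun i : 'I_r.+2 => extend_vert s nu i].

Lemma vert_extend r (s : vpath A r) nu n (le_nr : (n <= r)%N)
    (le_nrS : (n <= r.+1)%N) :
  vert (path_extend s nu) le_nrS = vert s le_nr.
Proof.
rewrite {1}/vert ffunE /extend_vert; case: decP => [h | []]; last exact: le_nr.
exact: vertE.
Qed.

Lemma vert_extend_last r (s : vpath A r) nu (le_rr : (r.+1 <= r.+1)%N) :
  vert (path_extend s nu) le_rr = nu.
Proof.
rewrite /vert ffunE /extend_vert; case: decP => [h | h] /=.
  by have := h; rewrite ltnn.
by rewrite eq_axiomK.
Qed.

Lemma path_extendK r (s : vpath A r) nu : path_trunc (path_extend s nu) = s.
Proof.
apply: vpath_ext => n le_nr.
by rewrite (vert_trunc _ _ (leqW le_nr)) vert_extend.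
Qed.

Lemma path_truncK r (t : vpath A r.+1) :
  path_extend (path_trunc t) (vert t (leqnn r.+1)) = t.
Proof.
apply: vpath_ext => n le_nr.
have /orP[/eqP en | lt_nr] : (n == r.+1) || (n <= r)%N by rewrite -leq_eqVlt.
  move: le_nr; rewrite en => le_nr.
  by rewrite vert_extend_last (eq_irrelevance le_nr (leqnn _)).
by rewrite (vert_extend _ _ lt_nr) (vert_trunc _ _ le_nr).
Qed.

Lemma Std_trunc r (nu : Lam A r.+1) (t : vpath A r.+1) :
  t \in Std nu ->
  [/\ path_trunc t \in Std (vert t (leqnSn r)), edge (vert t (leqnSn r)) nu
    & vert t (leqnn r.+1) = nu].
Proof.
case/StdP => t0 te tr; split=> //; last by rewrite -tr; apply: te.
apply/StdP; split.
- by rewrite (vert_trunc _ _ (leq0n _)).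
- move=> n lt_nr le_nr.
  rewrite (vert_trunc _ _ (leqW le_nr)) (vert_trunc _ _ (leqW lt_nr)).
  exact: te.
- by rewrite (vert_trunc _ _ (leqnSn r)).
Qed.

Lemma Std_extend r (mu : Lam A r) (nu : Lam A r.+1) (s : vpath A r) :
  edge mu nu -> s \in Std mu -> path_extend s nu \in Std nu.
Proof.
move=> emn /StdP[s0 se sr]; apply/StdP; split.
- by rewrite (vert_extend _ _ (leq0n _)).
- move=> n lt_nr le_nr.
  rewrite (vert_extend _ _ (lt_nr : (n <= r)%N)).
  have /orP[/eqP en | lt_nr'] : (n == r) || (n < r)%N by rewrite -leq_eqVlt.
    subst n; rewrite vert_extend_last.
    by rewrite (eq_irrelevance (lt_nr : (r <= r)%N) (leqnn r)) sr.
  by rewrite (vert_extend _ _ (lt_nr' : (n.+1 <= r)%N)); apply: se.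
- exact: vert_extend_last.
Qed.

(** Deleting the last vertex is what relates the Murphy basis of Δ(nu) to those
    of the subquotients of its restriction. *)
Lemma sum_Std_extend r (nu : Lam A r.+1) (V : zmodType) (F : vpath A r.+1 -> V) :
  \sum_(t in Std nu) F t
    = \sum_(mu | edge mu nu) \sum_(s in Std mu) F (path_extend s nu).
Proof.
rewrite (partition_big (fun t => vert t (leqnSn r)) (fun mu => edge mu nu)) /=.
  apply: eq_bigr => mu emn.
  rewrite (reindex_onto (fun s => path_extend s nu) (@path_trunc r)) /=.
    apply: eq_bigl => s; rewrite path_extendK eqxx andbT.
    rewrite (vert_extend _ _ (leqnn r)).
    apply/andP/idP => [[/Std_trunc[+ _ _] /eqP <-] | sS].
      by rewrite path_extendK (vert_extend _ _ (leqnn r)).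
    rewrite (Std_extend emn sS); split=> //.
    by case/StdP: sS => _ _ ->.
  by move=> t /andP[/Std_trunc[_ _ <-] _]; rewrite path_truncK.
by move=> t /Std_trunc[].
Qed.

Lemma path_d_trunc r (t : vpath A r.+1) :
  path_d t = bfac (vert t (leqnSn r)) (vert t (leqnn r.+1))
             * inc A r (path_d (path_trunc t)).
Proof.
rewrite /path_d enum_ordSr rev_rcons big_cons; congr (_ * _).
  by rewrite incl_id; congr bfac; apply: vertE.
rewrite -map_rev big_map rmorph_prod /=; apply: eq_bigr => -[n lt_nr] _.
rewrite -(inclS _ (leqW lt_nr)) (path_srcE _ _ (ltnW lt_nr)) path_tgtE.
rewrite (vert_trunc _ _ (leqW (ltnW lt_nr))) (vert_trunc _ _ (leqW lt_nr)) /=.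
set h := ltn_ord _; rewrite (eq_irrelevance h (leqW lt_nr)).
by congr (incl _ (bfac _ _)); apply: vertE.
Qed.

Lemma path_d_extend r (mu : Lam A r) (nu : Lam A r.+1) (s : vpath A r) :
  s \in Std mu ->
  path_d (path_extend s nu) = bfac mu nu * inc A r (path_d s).
Proof.
case/StdP=> _ _ sr; rewrite path_d_trunc path_extendK vert_extend_last.
by rewrite (vert_extend _ _ (leqnn r)) sr.
Qed.

End Paths.

(** * The Murphy basis and the cell filtrations *)

Section Filtration.
Variables (R : idomainType) (A : cell_tower R) (r : nat) (nu : Lam A r.+1).
Variable F : cell_filtration nu.

Lemma filt_lam_inj : injective (filt_lam (c := F)).
Proof.
have step n (i j : 'I_(filt_len F)) :
    j = (i + n.+1)%N :> nat -> (filt_lam j < filt_lam i)%O.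
  elim: n j => [|n IHn] j ej.
    by apply: filt_order; rewrite ej addn1.
  have lt_j : (i + n.+1 < filt_len F)%N.
    by apply: ltn_trans (ltn_ord j); rewrite ej !addnS.
  apply: lt_trans (IHn (Ordinal lt_j) erefl).
  by apply: filt_order; rewrite ej !addnS.
move=> i j eij; apply/eqP; case: (ltngtP i j) => // lij.
- have /step : j = (i + (j - i.+1).+1)%N :> nat by rewrite -subSn // subSS subnKC // ltnW.
  by rewrite eij ltxx.
- have /step : i = (j + (i - j.+1).+1)%N :> nat by rewrite -subSn // subSS subnKC // ltnW.
  by rewrite eij ltxx.
- exact/eqP/val_inj.
Qed.

Lemma filt_mod0 j : (j <= filt_len F)%N -> filt_mod F j 0.
Proof. by move=> /(filt_submod) []. Qed.

Lemma filt_mod_lin j k x y : (j <= filt_len F)%N ->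
  filt_mod F j x -> filt_mod F j y -> filt_mod F j (k *: x + y).
Proof. by move=> /(filt_submod) [_ + _]; apply. Qed.

Lemma filt_modD j x y : (j <= filt_len F)%N ->
  filt_mod F j x -> filt_mod F j y -> filt_mod F j (x + y).
Proof. by move=> le_j Mx My; rewrite -[x]scale1r; apply: filt_mod_lin. Qed.

Lemma filt_modZ j k x : (j <= filt_len F)%N ->
  filt_mod F j x -> filt_mod F j (k *: x).
Proof.
by move=> le_j Mx; rewrite -[_ *: _]addr0; apply: filt_mod_lin => //; apply: filt_mod0.
Qed.

Lemma filt_mod_act j x a : (j <= filt_len F)%N ->
  filt_mod F j x -> filt_mod F j (cell_act x (inc A r a)).
Proof. by move=> /(filt_submod) [_ _ +]; apply. Qed.

Lemma filt_mod_sum j (J : Type) (s : seq J) (P : pred J) (G : J -> Delta nu) :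
  (j <= filt_len F)%N -> (forall i, P i -> filt_mod F j (G i)) ->
  filt_mod F j (\sum_(i <- s | P i) G i).
Proof.
move=> le_j MG; elim/big_rec: _ => [|i x Pi Mx]; first exact: filt_mod0.
by apply: filt_modD => //; apply: MG.
Qed.

Lemma filt_mod_mono i j x : (i <= j)%N -> (j <= filt_len F)%N ->
  filt_mod F i x -> filt_mod F j x.
Proof.
move=> le_ij; elim: j le_ij => [|j IHj]; first by rewrite leqn0 => /eqP ->.
rewrite leq_eqVlt => /orP[/eqP -> //|lt_ij] lt_j Mx.
by apply: (@filt_incr _ _ _ _ F (Ordinal lt_j)); apply: IHj => //; apply: ltnW.
Qed.

Lemma filt_iso_eq0 (j : 'I_(filt_len F)) x : filt_mod F j.+1 x ->
  filt_iso j x = 0 <-> filt_mod F j x.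
Proof. by case: (filt_isoP j) => _ _ _ + Mx; apply. Qed.

Lemma filt_iso0 (j : 'I_(filt_len F)) : filt_iso j 0 = 0.
Proof. by apply/filt_iso_eq0; apply: filt_mod0 => //; apply: ltnW. Qed.

Lemma filt_iso_lin (j : 'I_(filt_len F)) k x y :
  filt_mod F j.+1 x -> filt_mod F j.+1 y ->
  filt_iso j (k *: x + y) = k *: filt_iso j x + filt_iso j y.
Proof. by case: (filt_isoP j) => + _ _ _; apply. Qed.

Lemma filt_iso_act (j : 'I_(filt_len F)) x a : filt_mod F j.+1 x ->
  filt_iso j (cell_act x (inc A r a)) = cell_act (filt_iso j x) a.
Proof. by case: (filt_isoP j) => _ + _ _; apply. Qed.

Lemma filt_iso_comb (j : 'I_(filt_len F)) (J : Type) (s : seq J) (P : pred J)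
    (c : J -> R) (G : J -> Delta nu) :
  (forall i, P i -> filt_mod F j.+1 (G i)) ->
  filt_iso j (\sum_(i <- s | P i) c i *: G i)
    = \sum_(i <- s | P i) c i *: filt_iso j (G i).
Proof.
move=> MG; elim: s => [|i s IHs]; first by rewrite !big_nil filt_iso0.
rewrite !big_cons; case: ifP => // Pi; rewrite filt_iso_lin ?IHs //; first exact: MG.
by apply: filt_mod_sum => // k Pk; apply/filt_modZ/MG.
Qed.

End Filtration.

Section MurphyBasis.
Variables (R : idomainType) (A : diagram_data R) (hA : diagram_axioms A).

Lemma edge_filt r (mu : Lam A r) (nu : Lam A r.+1) :
  edge mu nu -> exists k, filt_lam (c := res_filt nu) k = mu.
Proof. by case/existsP=> k /eqP; exists k. Qed.

Lemma filt_edge r (nu : Lam A r.+1) k : edge (filt_lam (c := res_filt nu) k) nu.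
Proof. by apply/existsP; exists k. Qed.

Lemma sum_edge_filt r (nu : Lam A r.+1) (V : zmodType) (G : Lam A r -> V) :
  \sum_(mu | edge mu nu) G mu = \sum_k G (filt_lam (c := res_filt nu) k).
Proof.
have -> : \sum_k G (filt_lam (c := res_filt nu) k)
    = \sum_(mu in [set filt_lam (c := res_filt nu) k | k in setT]) G mu.
  rewrite big_imset /=; first by apply: eq_bigl => k; rewrite inE.
  by move=> i j _ _; apply: filt_lam_inj.
apply: eq_bigl => mu; apply/idP/imsetP => [/edge_filt[k <-] | [k _ ->]].
  by exists k.
exact: filt_edge.
Qed.

(** The image of m^nu_t under the identification of (m_nu A + A^{▷ nu}) / A^{▷ nu}
    with Δ(nu), which sends the coset of m_nu to δ(nu). *)
Definition mvec r (nu : Lam A r) (t : vpath A r) : Delta nu :=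
  cell_act (delta nu) (path_d t).

Lemma mvec_extend r (nu : Lam A r.+1) k s :
  s \in Std (filt_lam (c := res_filt nu) k) ->
  filt_mod (res_filt nu) k.+1 (mvec nu (path_extend s nu)) /\
  filt_iso k (mvec nu (path_extend s nu)) = mvec (filt_lam k) s.
Proof.
move=> sS; rewrite /mvec (path_d_extend _ sS) cell_actM.
have [Mk isok] := bfac_filt hA k; split; first exact: filt_mod_act.
by rewrite filt_iso_act // isok.
Qed.

Lemma vpath0_unique (nu : Lam A 0) (s t : vpath A 0) : s = t.
Proof.
apply: vpath_ext => -[|//] h.
by rewrite (Lam0_triv hA (vert s h)) (Lam0_triv hA (vert t h)).
Qed.

Lemma Std0_inhabited (nu : Lam A 0) : exists t, t \in Std nu.
Proof.
exists [ffun i : 'I_1 => ecast j (Lam A (nat_of_ord j)) (esym (ord1 i)) (Lam_root A)].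
apply/StdP; split=> //; first exact: (Lam0_triv hA).
by rewrite (Lam0_triv hA nu); apply: (Lam0_triv hA).
Qed.

Lemma path_d0 (t : vpath A 0) : path_d t = 1.
Proof. by rewrite /path_d enum_ord0 big_nil. Qed.

Lemma delta0_neq0 (nu : Lam A 0) : delta nu <> 0.
Proof.
rewrite (Lam0_triv hA nu) => d0.
have /eqP/fintype1P[t0 _] := Delta0_triv hA.
have [a] := delta_cyclic hA ([ffun=> 1] : Delta (Lam_root A)).
rewrite d0 cell_act0l => /ffunP/(_ t0); rewrite !ffunE => /eqP.
by rewrite oner_eq0.
Qed.

(** A vector of the filtration step M_{k+1} can be corrected by Murphy vectors
    of paths through λ_k so as to fall into M_k. *)
Lemma murphy_span r (nu : Lam A r) x : in_span (mvec nu) (mem (Std nu)) x.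
Proof.
elim: r nu x => [|r IHr] nu x.
  have [t tS] := Std0_inhabited nu; have [a ->] := delta_cyclic hA x.
  have [b _ bK] := alg0_triv hA; rewrite -(bK a) cell_actZr cell_act1.
  apply: in_spanZ; rewrite -[delta nu]cell_act1 -(path_d0 t).
  exact: (in_span_basis (mvec nu)).
suff MS j : (j <= filt_len (res_filt nu))%N -> forall x,
    filt_mod (res_filt nu) j x -> in_span (mvec nu) (mem (Std nu)) x.
  by apply: MS (leqnn _) _ _; apply: filt_top.
elim: j {x} => [_ x /filt_bot ->|j IHj lt_j x]; first exact: in_span0.
pose k := Ordinal lt_j; rewrite -[j]/(val k) => Mx.
have [c cE] := IHr _ (filt_iso k x).
pose z := \sum_(s in Std (filt_lam k)) c s *: mvec nu (path_extend s nu).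
have Sz : in_span (mvec nu) (mem (Std nu)) z.
  apply: in_span_sum => s sS; apply/in_spanZ/(in_span_basis (mvec nu)).
  exact: Std_extend (filt_edge k) sS.
have Mz : filt_mod (res_filt nu) k.+1 z.
  apply: filt_mod_sum => // s sS.
  by apply: filt_modZ => //; case: (mvec_extend sS).
rewrite -(subrK z x); apply: in_spanD => //; apply: (IHj (ltnW lt_j)).
have Mxz : filt_mod (res_filt nu) k.+1 (x - z).
  by rewrite addrC -scaleN1r; apply: filt_mod_lin.
apply/(filt_iso_eq0 Mxz); rewrite addrC -scaleN1r filt_iso_lin // filt_iso_comb; last first.
  by move=> s /mvec_extend[].
rewrite scaleN1r cE; apply/eqP; rewrite addrC subr_eq0; apply/eqP.
by apply: eq_bigr => s /mvec_extend[_ ->].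
Qed.

(** Induction along the filtration, killing the coefficients one subquotient at
    a time from the top one: once those above k vanish, the combination lies in
    M_{k+1} and its image in M_{k+1} / M_k only sees the paths through λ_k.
    The predicates [Q] and [Qmu] cover two uses, being zero and being supported
    on a given set. *)
Lemma murphy_vanish_step r (nu : Lam A r.+1) (Q : Delta nu -> Prop)
    (Qmu : forall mu : Lam A r, Delta mu -> Prop) (c : vpath A r.+1 -> R) :
  (forall (k : 'I_(filt_len (res_filt nu))) x,
     filt_mod (res_filt nu) k.+1 x -> Q x ->
     Qmu (filt_lam k) (filt_iso k x)) ->
  (forall mu, Qmu mu (\sum_(s in Std mu) c (path_extend s nu) *: mvec mu s) ->
     forall s, s \in Std mu -> c (path_extend s nu) = 0) ->
  Q (\sum_(t in Std nu) c t *: mvec nu t) ->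
  forall t, t \in Std nu -> c t = 0.
Proof.
move=> Qiso Qc; rewrite sum_Std_extend sum_edge_filt.
pose y (k : 'I_(filt_len (res_filt nu))) : Delta nu :=
  \sum_(s in Std (filt_lam k)) c (path_extend s nu) *: mvec nu (path_extend s nu).
rewrite -/(\sum_k y k) => Qx.
have My (k : 'I_(filt_len (res_filt nu))) : filt_mod (res_filt nu) k.+1 (y k).
  apply: filt_mod_sum => // s sS; apply: filt_modZ => //.
  by case: (mvec_extend sS).
have c0 n (k : 'I_(filt_len (res_filt nu))) : (filt_len (res_filt nu) - k <= n)%N ->
    forall s, s \in Std (filt_lam k) -> c (path_extend s nu) = 0.
  elim: n k => [|n IHn] k le_n.
    by have := ltn_ord k; rewrite -subn_gt0 ltnNge le_n.
  apply: Qc.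
  have y0 (l : 'I_(filt_len (res_filt nu))) : (k < l)%N -> y l = 0.
    move=> lt_kl; apply: big1 => s sS; rewrite (IHn l) ?scale0r //.
    by rewrite -ltnS; apply: leq_trans le_n; apply: ltn_sub2l.
  pose w := \sum_(l < filt_len (res_filt nu) | (l < k)%N) y l.
  have Mw : filt_mod (res_filt nu) k w.
    apply: filt_mod_sum => [|l lt_lk]; first exact: ltnW.
    by apply: filt_mod_mono (My l) => //; apply: ltnW.
  have Mw' : filt_mod (res_filt nu) k.+1 w by apply: filt_incr.
  have xE : \sum_l y l = 1 *: y k + w.
    rewrite scale1r (bigD1 k) //=; congr (_ + _); rewrite /w.
    rewrite (bigID (fun l : 'I_(filt_len (res_filt nu)) => (l < k)%N)) /=.
    rewrite [X in _ + X]big1 ?addr0 => [|l /andP[lk]]; last first.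
      by rewrite -leqNgt leq_eqVlt eq_sym (inj_eq val_inj) (negbTE lk) => /y0.
    apply: eq_bigl => l; case: (ltnP l k) => lk; rewrite ?andbF // andbT.
    by apply: contraTneq lk => ->; rewrite ltnn.
  have Mx : filt_mod (res_filt nu) k.+1 (\sum_l y l).
    by rewrite xE; apply: filt_mod_lin.
  have := Qiso k _ Mx Qx; rewrite xE filt_iso_lin // scale1r.
  rewrite (proj2 (filt_iso_eq0 Mw') Mw) addr0 filt_iso_comb; last first.
    by move=> s /mvec_extend[].
  by rewrite (eq_bigr _ (fun s sS => congr1 _ (proj2 (mvec_extend sS)))).
move=> t tS; have [sS /edge_filt[k kE] tE] := Std_trunc tS.
rewrite -(path_truncK t) tE.
by apply: (c0 _ k (leqnn _)); rewrite kE.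
Qed.

Lemma murphy_free r (nu : Lam A r) (c : vpath A r -> R) :
  \sum_(t in Std nu) c t *: mvec nu t = 0 -> forall t, t \in Std nu -> c t = 0.
Proof.
elim: r nu c => [|r IHr] nu c.
  move=> c0 t tS; move: c0; rewrite (big_pred1 t) => [|s]; last first.
    by rewrite (vpath0_unique nu s t) tS /= eqxx.
  rewrite /mvec path_d0 cell_act1 => ct0; apply/eqP.
  apply: contra_notT (delta0_neq0 (nu := nu)) => cn0.
  apply/ffunP => v; rewrite ffunE; apply: (mulfI cn0).
  by have /ffunP/(_ v) := ct0; rewrite !ffunE mulr0.
apply: (murphy_vanish_step (Q := fun x => x = 0) (Qmu := fun mu x => x = 0)).
  by move=> k _ _ ->; apply: filt_iso0.
by move=> mu /IHr.
Qed.

(** * Passing between m_nu A and the cell module *)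

Lemma cell_m_row r (nu : Lam A r) s a :
  cell_row s (cell_m nu * a) = (delta nu s : R) *: cell_act (delta nu) a.
Proof.
rewrite cell_row_mul; last exact: cell_m_ge.
rewrite -cell_actZl; congr cell_act; apply/ffunP => t.
by have /ffunP/(_ (s, t)) := cell_m_alpha hA nu; rewrite !ffunE.
Qed.

Lemma cell_eq_delta r (nu : Lam A r) a b :
  cell_act (delta nu) a = cell_act (delta nu) b ->
  cell_eq nu (cell_m nu * a) (cell_m nu * b).
Proof.
move=> ab; rewrite /cell_eq -mulrBr; apply: cell_gt_row => [|s].
  by apply: cell_ideal_mulr (cell_m_ge hA nu); apply: up_closed_ge.
by rewrite cell_m_row cell_actBr ab subrr scaler0.
Qed.

(** In coordinates, m_nu a is δ ⊗ (δ a); over an integral domain this vanishes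
    only if δ = 0 or δ a = 0, and the first case implies the second. *)
Lemma delta_act_eq0 r (nu : Lam A r) a :
  cell_m nu * a = 0 -> cell_act (delta nu) a = 0.
Proof.
move=> ma0; apply/ffunP => v; rewrite [RHS]ffunE; apply/eqP/negPn/negP => av0.
have d0 : delta nu = 0.
  apply/ffunP => s; rewrite [RHS]ffunE; apply: (mulIf av0); rewrite mul0r.
  have := cell_m_row s a; rewrite ma0 => /ffunP/(_ v).
  by rewrite [LHS]ffunE basis_coord0 [RHS]ffunE => e; apply: esym e.
by case/eqP: av0; rewrite d0 cell_act0l ffunE.
Qed.

(** Because m_nu d_{mu -> nu} = u^* m_mu holds in the algebra itself, and not
    only modulo A^{▷ nu}, the element m_nu d_t factors through m_{t(j)} for
    every level j. *)
Lemma murphy_factor r (nu : Lam A r) t j (le_jr : (j <= r)%N) : t \in Std nu ->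
  exists u : alg A r, exists a : alg A j,
    murphy nu t = u * incl le_jr (cell_m (vert t le_jr) * a).
Proof.
elim: r nu t le_jr => [|r IHr] nu t le_jr tS.
  case: j le_jr => // le_jr; exists 1, (path_d t); rewrite incl_id mul1r.
  by rewrite (Lam0_triv hA nu) (Lam0_triv hA (vert t le_jr)).
have /orP[/eqP ejr | le_jr'] : (j == r.+1) || (j <= r)%N by rewrite -leq_eqVlt.
  subst j; exists 1, (path_d t); rewrite incl_id mul1r.
  by have [_ _ <-] := Std_trunc tS; rewrite (eq_irrelevance le_jr (leqnn _)).
have [sS e tE] := Std_trunc tS.
have [v vE] := bfac_compat hA e.
have [u [a uE]] := IHr _ _ le_jr' sS.
exists (star (cel A r.+1) v * inc A r u), a.
rewrite /murphy path_d_trunc tE mulrA vE -mulrA -rmorphM.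
rewrite -/(murphy _ _) uE rmorphM /= mulrA (vert_trunc _ _ le_jr).
by rewrite -(inclS le_jr').
Qed.

(** * Vectors supported at a level on an up-closed set *)

(** The part of Δ_r(nu) on which A_j acts through the cell ideal spanned by
    [S]: over the field of fractions it is Δ(nu) e for the central idempotent e
    of A_j that generates the ideal.  The description by annihilators avoids
    denominators. *)
Definition supported r j (le_jr : (j <= r)%N) (nu : Lam A r)
    (S : pred (Lam A j)) (x : Delta nu) : Prop :=
  forall b : alg A j,
    (forall y, cell_ideal (C := cel A j) S y -> y * b = 0) ->
    cell_act x (incl le_jr b) = 0.

Section Supported.
Variables (r j : nat) (le_jr : (j <= r)%N) (nu : Lam A r) (S : pred (Lam A j)).
Hypothesis Su : up_closed S.
Local Notation supp := (supported le_jr (nu := nu) S).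

Lemma supported0 : supp 0.
Proof. by move=> b _; rewrite cell_act0l. Qed.

Lemma supportedD x y : supp x -> supp y -> supp (x + y).
Proof. by move=> sx sy b bS; rewrite cell_actDl sx // sy // addr0. Qed.

Lemma supportedZ k x : supp x -> supp (k *: x).
Proof. by move=> sx b bS; rewrite cell_actZl sx // scaler0. Qed.

Lemma supported_act x a : supp x -> supp (cell_act x (incl le_jr a)).
Proof.
move=> sx b bS; rewrite -cell_actM -incl_mul; apply: sx => y Sy.
by rewrite mulrA; apply/bS/cell_ideal_mulr.
Qed.

Lemma supported_act_comm x a :
  (forall b, a * incl le_jr b = incl le_jr b * a) ->
  supp x -> supp (cell_act x a).
Proof.
by move=> ca sx b bS; rewrite -cell_actM ca cell_actM sx // cell_act0l.
Qed.

Lemma supported_delta a u y :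
  cell_ideal S y -> cell_m nu * a = u * incl le_jr y ->
  supp (cell_act (delta nu) a).
Proof.
move=> Sy ma b bS; rewrite -cell_actM; apply: delta_act_eq0.
by rewrite mulrA ma -mulrA -incl_mul bS // incl_0 mulr0.
Qed.

Lemma supported_mvec t : t \in Std nu -> S (vert t le_jr) -> supp (mvec nu t).
Proof.
move=> tS St; have [u [a uE]] := murphy_factor le_jr tS.
apply: supported_delta uE; apply: cell_ideal_mulr => //.
apply: in_span_sub (cell_m_ge hA (vert t le_jr)) => i /Su; exact.
Qed.

End Supported.

Lemma supported_out r (nu : Lam A r) (S : pred (Lam A r)) (x : Delta nu) :
  up_closed S -> ~~ S nu -> supported (leqnn r) S x -> x = 0.
Proof.
move=> Su nS sx; have [B [phi [phiP ssB]]] := generic_semisimple hA r.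
have [b [k [k0 bS bk]]] := cell_ideal_annihilator phiP ssB Su nS.
have := sx b bS; rewrite incl_id bk => kx; apply/ffunP => v.
by rewrite [RHS]ffunE; apply: (mulfI k0); have /ffunP/(_ v) := kx;
   rewrite !ffunE mulr0.
Qed.

(** The Murphy vectors of the paths with t(j) in [S] are supported on [S], so
    they can be subtracted; what remains is supported on [S] and involves only
    the other paths, and by induction its image in each subquotient of the
    restriction is zero. *)
Lemma supported_coord r (nu : Lam A r) j (le_jr : (j <= r)%N)
    (S : pred (Lam A j)) (c : vpath A r -> R) :
  up_closed S -> supported le_jr S (\sum_(t in Std nu) c t *: mvec nu t) ->
  forall t, t \in Std nu -> ~~ S (vert t le_jr) -> c t = 0.
Proof.
move=> Su; elim: r nu le_jr c => [|r IHr] nu le_jr c.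
  case: j le_jr S Su => // le_jr S Su sx t tS nS.
  rewrite (Lam0_triv hA (vert t le_jr)) -(Lam0_triv hA nu) in nS.
  rewrite (eq_irrelevance le_jr (leqnn _)) in sx.
  exact: (murphy_free (supported_out Su nS sx)).
have /orP[/eqP ejr | le_jr'] : (j == r.+1) || (j <= r)%N by rewrite -leq_eqVlt.
  subst j; rewrite (eq_irrelevance le_jr (leqnn _)) => sx t tS nS.
  have [_ _ tE] := Std_trunc tS; rewrite tE in nS.
  exact: (murphy_free (supported_out Su nS sx)).
move=> sx; pose c' t := if S (vert t le_jr) then 0 else c t.
suff c'0 : forall t, t \in Std nu -> c' t = 0.
  by move=> t tS nS; have := c'0 t tS; rewrite /c' (negbTE nS).
have sx' : supported le_jr S (\sum_(t in Std nu) c' t *: mvec nu t).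
  have -> : \sum_(t in Std nu) c' t *: mvec nu t =
      \sum_(t in Std nu) c t *: mvec nu t +
      \sum_(t in Std nu) (if S (vert t le_jr) then - c t else 0) *: mvec nu t.
    rewrite -big_split /=; apply: eq_bigr => t _; rewrite -scalerDl /c'.
    by case: ifP; rewrite ?subrr ?addr0.
  apply: supportedD sx _; elim/big_rec: _ => [|t y tS sy]; first exact: supported0.
  apply: supportedD sy; case: ifP => St; last by rewrite scale0r; apply: supported0.
  by apply: supportedZ; apply: supported_mvec.
apply: (murphy_vanish_step (Qmu := fun mu => supported le_jr' (nu := mu) S)) sx'.
  move=> k x Mx sx' b bS; rewrite -filt_iso_act // -(inclS _ le_jr).
  by rewrite sx' // filt_iso0.
move=> mu sy s sS; case: (boolP (S (vert s le_jr'))) => [Ss | nS].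
  by rewrite /c' (vert_extend _ _ le_jr') Ss.
exact: (IHr _ _ (fun s => c' (path_extend s nu)) sy s sS nS).
Qed.

End MurphyBasis.

(** * Coefficients in the Murphy basis *)

Section MurphyCoefficients.
Variables (R : idomainType) (A : diagram_data R) (hA : diagram_axioms A).
Variables (r : nat) (nu : Lam A r).

(** A relation rather than a function, because the index set of the basis is a
    set of paths and not a type. *)
Definition murphy_coef (t : vpath A r) (x : Delta nu) (k : R) : Prop :=
  exists2 c : vpath A r -> R,
    x = \sum_(s in Std nu) c s *: mvec nu s & c t = k.

Lemma murphy_coef_lin t a x y k l :
  murphy_coef t x k -> murphy_coef t y l ->
  murphy_coef t (a *: x + y) (a * k + l).
Proof.
move=> [c -> <-] [c' -> <-]; exists (fun s => a * c s + c' s) => //.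
rewrite scaler_sumr -big_split /=.
by apply: eq_bigr => s _; rewrite scalerA scalerDl.
Qed.

Lemma murphy_coef_ex t x : exists k, murphy_coef t x k.
Proof. by have [c cE] := murphy_span hA x; exists (c t), c. Qed.

Lemma murphy_coef_mvec t : t \in Std nu -> murphy_coef t (mvec nu t) 1.
Proof.
move=> tS; exists (fun s => (s == t)%:R); last by rewrite eqxx.
rewrite (bigD1 t) //= eqxx scale1r big1 ?addr0 // => s /andP[_ /negbTE ->].
by rewrite scale0r.
Qed.

Lemma murphy_coef_unique t x k l :
  t \in Std nu -> murphy_coef t x k -> murphy_coef t x l -> k = l.
Proof.
move=> tS [c xc <-] [c' xc' <-]; apply/eqP; rewrite -subr_eq0; apply/eqP.
apply: (murphy_free hA (c := fun s => c s - c' s) (nu := nu)) tS.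
rewrite -[RHS](subrr x) {1}xc xc' -sumrB.
by apply: eq_bigr => s _; rewrite scalerBl.
Qed.

Lemma supported_coef t x j (le_jr : (j <= r)%N) (S : pred (Lam A j)) :
  t \in Std nu -> up_closed S -> ~~ S (vert t le_jr) ->
  supported le_jr S x -> murphy_coef t x 0.
Proof.
move=> tS Su nS; have [c cE] := murphy_span hA x.
by rewrite {1}cE => sx; exists c => //; apply: (supported_coord hA Su sx tS nS).
Qed.

End MurphyCoefficients.

(** * Jucys-Murphy elements *)

Section JucysMurphy.
Variables (R : idomainType) (A : diagram_data R) (hA : diagram_axioms A).
Variables (kind : JM_kind) (L : forall r : nat, alg A r).
Variable d : forall r : nat, Lam A r -> R.
Hypothesis hL : JM_family kind L d.

(** The combination of L_1, ..., L_r that acts on each Δ_r(λ) as the scalar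
    d(λ). *)
Definition JM_total r : alg A r :=
  match kind with
  | JM_additive => \sum_(i < r) incl (ltn_ord i) (L i.+1)
  | JM_multiplicative => \prod_(i < r) incl (ltn_ord i) (L i.+1)
  end.

Lemma JM_commute r (a : alg A r) : L r.+1 * inc A r a = inc A r a * L r.+1.
Proof. by have [_] : JM_common L by case: kind hL => -[]. Qed.

Lemma JM_total_scalar r (l : Lam A r) : acts_as_scalar l (JM_total r) (d l).
Proof.
case: r l => [|r] l; last by rewrite /JM_total; case: kind hL => -[? + +]; auto.
by rewrite (Lam0_triv hA l) /JM_total; case: kind hL => -[] => [_ _|_ _ _] -> x;
  rewrite big_ord0 ?cell_act0r ?scale0r ?cell_act1 ?scale1r.
Qed.

Lemma JM_total_recr r :
  JM_total r.+1 = match kind with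
                  | JM_additive => inc A r (JM_total r) + L r.+1
                  | JM_multiplicative => inc A r (JM_total r) * L r.+1
                  end.
Proof.
rewrite /JM_total; case: kind.
  rewrite big_ord_recr /= incl_id raddf_sum /=; congr (_ + _).
  by apply: eq_bigr => i _; apply: inclS.
rewrite big_ord_recr /= incl_id rmorph_prod /=; congr (_ * _).
by apply: eq_bigr => i _; apply: inclS.
Qed.

Lemma JM_total_inverse r : kind = JM_multiplicative ->
  exists b, JM_total r * b = 1.
Proof.
move=> kM; elim: r => [|r [b bE]].
  by exists 1; rewrite /JM_total kM big_ord0 mulr1.
have [c [cE _]] : exists c : alg A r.+1, L r.+1 * c = 1 /\ c * L r.+1 = 1.
  by move: hL; rewrite kM => -[].
exists (c * inc A r b); rewrite JM_total_recr kM -mulrA (mulrA (L _)) cE mul1r.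
by rewrite -rmorphM bE rmorph1.
Qed.

(** [L i.+1] lies in A_j for i < j and commutes with A_j for j <= i; in both
    cases it preserves the vectors supported on [S] at level [j]. *)
Lemma supported_JM r (nu : Lam A r) j (le_jr : (j <= r)%N)
    (S : pred (Lam A j)) (x : Delta nu) i (lt_ir : (i < r)%N) :
  up_closed S -> supported le_jr S x ->
  supported le_jr S (cell_act x (incl lt_ir (L i.+1))).
Proof.
move=> Su sx; case: (leqP j i) => [le_ji | lt_ij]; last first.
  by rewrite -(incl_trans lt_ij le_jr); apply: supported_act.
apply: supported_act_comm => // b.
rewrite -(incl_trans le_ji (ltnW lt_ir)) -(inc_incl (ltnW lt_ir) lt_ir).
by rewrite -!incl_mul JM_commute.
Qed.

(** A_j acts on m_nu d_t = u m_{t(j)} a as it does on Δ(t(j)), up to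
    A_r A_j^{▷ t(j)}. *)
Lemma JM_total_mvec r (nu : Lam A r) t j (le_jr : (j <= r)%N) : t \in Std nu ->
  supported le_jr (fun m => (vert t le_jr < m)%O)
    (cell_act (mvec nu t) (incl le_jr (JM_total j))
     - d (vert t le_jr) *: mvec nu t).
Proof.
move=> tS; rewrite /mvec -cell_actM -cell_actZr -cell_actBr.
have [u [a uE]] := murphy_factor hA le_jr tS.
have ge_ma : cell_ge (vert t le_jr) (cell_m (vert t le_jr) * a).
  by apply: cell_ideal_mulr (cell_m_ge hA _); apply: up_closed_ge.
apply: (supported_delta hA (u := u) (y := cell_m (vert t le_jr) * a * JM_total j
    - d (vert t le_jr) *: (cell_m (vert t le_jr) * a))).
  exact: (cell_ge_scalar ge_ma (JM_total_scalar (l := vert t le_jr))).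
rewrite mulrBr mulrA -scalerAr -/(murphy nu t) uE -(mulrA u) -incl_mul.
by rewrite scalerAr -incl_Z -mulrBr -incl_B.
Qed.

Section DiagonalCoefficient.
Variables (r : nat) (nu : Lam A r) (t : vpath A r) (tS : t \in Std nu).

Lemma JM_total_mvecE j (le_jr : (j <= r)%N) :
  exists2 z, supported le_jr (fun m => (vert t le_jr < m)%O) z
    & cell_act (mvec nu t) (incl le_jr (JM_total j))
      = d (vert t le_jr) *: mvec nu t + z.
Proof.
exists (cell_act (mvec nu t) (incl le_jr (JM_total j))
        - d (vert t le_jr) *: mvec nu t); first exact: JM_total_mvec.
by rewrite addrC subrK.
Qed.

Lemma supported_gt_coef j (le_jr : (j <= r)%N) (z : Delta nu) :
  supported le_jr (fun m => (vert t le_jr < m)%O) z -> murphy_coef t z 0.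
Proof.
by apply: supported_coef => //; [apply: up_closed_gt | rewrite ltxx].
Qed.

Lemma JM_total_coef j (le_jr : (j <= r)%N) :
  murphy_coef t (cell_act (mvec nu t) (incl le_jr (JM_total j)))
    (d (vert t le_jr)).
Proof.
have [z sz ->] := JM_total_mvecE le_jr.
rewrite -[X in murphy_coef _ _ X]addr0 -[X in murphy_coef _ _ (X + _)]mulr1.
exact: murphy_coef_lin (murphy_coef_mvec tS) (supported_gt_coef sz).
Qed.

(** J_j has an inverse b, and the coefficient at [t] of m_t b is an inverse of
    d(t(j)): multiply m_t J_j = d(t(j)) m_t + z by b and compare coefficients,
    z b being again supported strictly above t(j).  Thus the quotient in
    [kappa] is a true one. *)
Lemma JM_scalar_unit j (le_jr : (j <= r)%N) : kind = JM_multiplicative ->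
  d (vert t le_jr) \is a GRing.unit.
Proof.
move=> kM; have [b bE] := JM_total_inverse j kM.
have [z sz zE] := JM_total_mvecE le_jr.
have zb : murphy_coef t (cell_act z (incl le_jr b)) 0.
  by apply: (@supported_gt_coef _ le_jr); apply: supported_act sz; apply: up_closed_gt.
have [k kb] := murphy_coef_ex hA t (cell_act (mvec nu t) (incl le_jr b)).
have /(murphy_coef_unique hA tS (murphy_coef_mvec tS)) dk :
    murphy_coef t (mvec nu t) (d (vert t le_jr) * k + 0).
  have -> : mvec nu t = d (vert t le_jr) *: cell_act (mvec nu t) (incl le_jr b)
                        + cell_act z (incl le_jr b).
    by rewrite -cell_actZl -cell_actDl -zE -cell_actM -incl_mul bE incl_1 cell_act1.
  exact: murphy_coef_lin.
by apply/unitrPr; exists k; rewrite dk addr0.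
Qed.

(** J_i = J_{i-1} + L_i, respectively J_i = J_{i-1} L_i.  In the second case L_i
    commutes with A_{i-1}, hence keeps the error term of m_t J_{i-1} supported
    strictly above t(i-1), and d(t(i)) is d(t(i-1)) times the coefficient. *)
Lemma JM_coef (i : 'I_r) :
  murphy_coef t (cell_act (mvec nu t) (incl (ltn_ord i) (L i.+1)))
    (kappa kind d (path_src t i) (path_tgt t i)).
Proof.
case: i => i lt_ir; rewrite (path_srcE _ _ (ltnW lt_ir)) path_tgtE /=.
set h := ltn_ord _; rewrite (eq_irrelevance h lt_ir).
set x := cell_act _ _.
have [k kx] := murphy_coef_ex hA t x.
have d1 := JM_total_coef lt_ir; have d0 := JM_total_coef (ltnW lt_ir).
suff <- : k = kappa kind d (vert t (ltnW lt_ir)) (vert t lt_ir) by [].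
rewrite JM_total_recr in d1.
rewrite /kappa; case: {-1}kind (erefl kind) => kE; rewrite kE in d1.
- apply/eqP; rewrite eq_sym subr_eq addrC; apply/eqP.
  apply: (murphy_coef_unique hA tS d1).
  rewrite incl_D (inc_incl (ltnW lt_ir)) cell_actDr.
  rewrite -[X in murphy_coef _ (X + _)]scale1r -[X in X + k]mul1r.
  apply: murphy_coef_lin => //.
- have u0 := JM_scalar_unit (ltnW lt_ir) kE.
  apply: (mulrI u0); rewrite mulrCA divrr // mulr1.
  apply/esym/(murphy_coef_unique hA tS d1).
  rewrite incl_mul (inc_incl (ltnW lt_ir)) cell_actM.
  have [z sz ->] := JM_total_mvecE (ltnW lt_ir).
  rewrite cell_actDl cell_actZl -[_ * k]addr0.
  apply: murphy_coef_lin => //.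
  apply: (@supported_gt_coef _ (ltnW lt_ir)).
  by apply: supported_JM sz; apply: up_closed_gt.
Qed.

End DiagonalCoefficient.
End JucysMurphy.

(* The index i of 'I_r stands for the level i+1, so that 1 <= i+1 <= r. *)
Theorem theorem4p7 (R : idomainType) (A : diagram_data R)
    (hA : diagram_axioms A) (k : JM_kind)
    (L : forall r : nat, alg A r) (d : forall r : nat, Lam A r -> R)
    (hL : JM_family k L d)
    (r : nat) (lam : Lam A r) (t : vpath A r) (ht : t \in Std lam) (i : 'I_r) :
  exists c : vpath A r -> R,
    cell_eq lam
      (murphy lam t * incl (ltn_ord i) (L i.+1))
      (kappa k d (path_src t i) (path_tgt t i) *: murphy lam t
       + \sum_(s in Std lam | path_gt s t) c s *: murphy lam s).
Proof.
have [c xE ct] := JM_coef hA hL ht i; exists c.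
(* If s is not above t, some level j separates them, and m_t L_i is supported
   on the vertices above t(j), which leaves out s(j). *)
have c0 s : s \in Std lam -> s != t -> ~~ path_gt s t -> c s = 0.
  rewrite /path_gt => sS -> /=; rewrite andbT => /forallPn[[j lt_jr] nle].
  have le_jr : (j <= r)%N by [].
  have Su := @up_closed_ge _ _ (cel A j) (vert t le_jr).
  move: xE; set x := cell_act _ _ => xE.
  have sx : supported le_jr (fun m => (vert t le_jr <= m)%O) x.
    by apply: (supported_JM hL) => //; apply: supported_mvec.
  rewrite xE in sx; apply: (supported_coord hA Su sx sS).
  by rewrite /= -!(vertE _ lt_jr).
rewrite /murphy scalerAr.
under eq_bigr do rewrite scalerAr.
rewrite -mulr_sumr -mulrDr -mulrA; apply: (cell_eq_delta hA).
rewrite cell_actM xE cell_actDr cell_actZr cell_act_sumr (bigD1 t) //= ct.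
congr (_ + _); rewrite (bigID (fun s => path_gt s t)) /=.
rewrite [X in _ + X]big1 ?addr0 => [|s /andP[/andP[sS st] nst]]; last first.
  by rewrite c0 ?scale0r.
apply: eq_big => [s|s _]; last by rewrite cell_actZr.
by rewrite -andbA; congr (_ && _); rewrite /path_gt; case: (s != t); rewrite ?andbF.
Qed.
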